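(* The parameterized problems \textsc{Dual Minimum Distance} and \textsc{Dual Weight Distribution} both belong to $\mathrm{W}[2]$.
   Context: \textsc{Dual Minimum Distance}: Input: an $m\times n$ matrix $H$ with entries in $\mathbb F_2$ and an integer $k$. Parameter: $k$. Question: is there a non-empty set of at least $n-k$ columns of $H$ that sum (over $\mathbb F_2$) to the all-zero vector? \textsc{Dual Weight Distribution}: Input: an $m\times n$ matrix $H$ with entries in $\mathbb F_2$ and an integer $k$. Parameter: $k$. Question: is there a set of exactly $n-k$ columns of $H$ that sum (over $\mathbb F_2$) to the all-zero vector? *)

(* Defs.v *)
From HB Require Import structures.
From mathcomp Require Import all_boot all_order all_algebra.
Set Implicit Arguments.
Unset Strict Implicit.
Unset Printing Implicit Defensive.

(* A cell is blank ([None]), holds an input symbol, or holds one of the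
   machine's additional work symbols. *)
Definition cell (G : Type) := option (bool + G).

Inductive dir := Left | Stay | Right.

(* A two-way infinite tape with finitely many non-blank cells. [left] lists the
   cells left of the head and [right] those right of it, nearest cell first;
   everything beyond the end of either list is blank. *)
Record tape (G : Type) := Tape
  { left : seq (cell G); cur : cell G; right : seq (cell G) }.

Definition write G (c : cell G) (t : tape G) := Tape (left t) c (right t).

Definition move G (d : dir) (t : tape G) : tape G :=
  match d with
  | Left => Tape (behead (left t)) (head None (left t)) (cur t :: right t)
  | Stay => t
  | Right => Tape (cur t :: left t) (head None (right t)) (behead (right t))
  end.

(* A deterministic multi-tape Turing machine with input alphabet [bool]. The
   transition function returns the next state and, for every tape, the
   symbol to write and the head movement; [None] means that the machine halts. *)
Record machine := Machine {
  work : finType;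
  state : finType;
  start : state;
  ntapes : nat; (* one less than the number of tapes *)
  delta : state -> {ffun 'I_ntapes.+1 -> cell work} ->
          option (state * {ffun 'I_ntapes.+1 -> cell work * dir})
}.

Definition config (M : machine) :=
  (state M * {ffun 'I_(ntapes M).+1 -> tape (work M)})%type.

Definition step (M : machine) (c : config M) : option (config M) :=
  if delta c.1 [ffun i => cur (c.2 i)] is Some (q, act)
  then Some (q, [ffun i => move (act i).2 (write (act i).1 (c.2 i))])
  else None.

Fixpoint run (M : machine) (t : nat) (c : config M) : config M :=
  if t is t'.+1 then (if step c is Some c' then run t' c' else c) else c.

Definition input_tape G (x : seq bool) : tape G :=
  let s := [seq Some (inl b) | b <- x] in Tape [::] (head None s) (behead s).

(* The input is on tape 0, the head on its first symbol. *)
Definition init (M : machine) (x : seq bool) : config M :=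
  (start M,
   [ffun i => if i == ord0 then input_tape (work M) x else Tape [::] None [::]]).

(* The longest block of input symbols starting at the head. *)
Fixpoint read_bits G (s : seq (cell G)) : seq bool :=
  if s is Some (inl b) :: s' then b :: read_bits s' else [::].

(* The output is read from the last tape. *)
Definition output (M : machine) (c : config M) : seq bool :=
  let t := c.2 ord_max in read_bits (cur t :: right t).

Definition outputs_within (M : machine) (x : seq bool) (t : nat)
    (y : seq bool) : Prop :=
  let c := run t (init M x) in step c = None /\ output c = y.

Definition computable (f : nat -> nat) : Prop :=
  exists M : machine, forall k : nat,
  exists t : nat, outputs_within M (nseq k true) t (nseq (f k) true).

(* A subset of {0,1}^* x N. *)
Definition pproblem := seq bool -> nat -> Prop.

(* 1^n 0; self-delimiting *)
Definition unary (n : nat) : seq bool := rcons (nseq n true) false.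

Definition pair_code (x : seq bool) (k : nat) : seq bool := unary k ++ x.

(* Running time f(k) (|x|+1)^c rather than f(k) |x|^c only so that the bound is
   meaningful for the empty string. *)
Definition fpt_reducible (P P' : pproblem) : Prop :=
  exists (M : machine) (f g : nat -> nat) (c : nat),
  [/\ computable f, computable g &
      forall (x : seq bool) (k : nat), exists (x' : seq bool) (k' : nat),
      [/\ outputs_within M (pair_code x k) (f k * (size x).+1 ^ c)
            (pair_code x' k'),
          k' <= g k &
          P x k <-> P' x' k']].

(* The wires of a circuit are numbered: 0, ..., n-1 are the [n = ninputs] input
   nodes and wire [n + i] is the output of the [i]-th gate. The last wire is the
   output node. [And [::]] and [Or [::]] are the constants. *)
Inductive gate := Not of nat | And of seq nat | Or of seq nat.

Record circuit := Circuit { ninputs : nat; gates : seq gate }.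

Definition fanin (g : gate) : seq nat :=
  match g with Not j => [:: j] | And l => l | Or l => l end.

(* There is at least one node, and every gate only reads earlier wires. *)
Definition wf_circuit (C : circuit) : Prop :=
  0 < ninputs C + size (gates C) /\
  forall i, i < size (gates C) ->
    all (fun j => j < ninputs C + i) (fanin (nth (Not 0) (gates C) i)).

(* Labels the wires in order, given the labels [w] of the inputs; [h] computes
   the label of a gate from the labels of the earlier wires. Returns the label
   of the output node. *)
Definition sweep T (x0 : T) (h : gate -> (nat -> T) -> T) (w : seq T)
    (gs : seq gate) : T :=
  last x0 (foldl (fun v g => rcons v (h g (nth x0 v))) w gs).

Definition gate_value (g : gate) (v : nat -> bool) : bool :=
  match g with Not j => ~~ v j | And l => all v l | Or l => has v l end.

Definition circuit_value (C : circuit) (a : (ninputs C).-tuple bool) : bool :=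
  sweep false gate_value a (gates C).

(* Maximum number of gates on a path to the output node. *)
Definition depth (C : circuit) : nat :=
  sweep 0 (fun g v => (\max_(j <- fanin g) v j).+1)
    (nseq (ninputs C) 0) (gates C).

(* Maximum number of large gates (fan-in more than 2) on such a path. *)
Definition weft (C : circuit) : nat :=
  sweep 0 (fun g v => (2 < size (fanin g)) + \max_(j <- fanin g) v j)
    (nseq (ninputs C) 0) (gates C).

(* Wire numbers are written in unary, which is polynomially equivalent to binary
   since they are smaller than the number of nodes. *)
Definition wires_code (l : seq nat) : seq bool :=
  rcons (flatten [seq true :: unary j | j <- l]) false.

Definition gate_code (g : gate) : seq bool :=
  match g with
  | Not j => false :: unary j
  | And l => [:: true, false & wires_code l]
  | Or l => [:: true, true & wires_code l]
  end.

Definition circuit_code (C : circuit) : seq bool :=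
  unary (ninputs C) ++ flatten [seq gate_code g | g <- gates C].

(* Weighted circuit satisfiability for circuits of weft at most [t] and depth at
   most [d]; the parameter is the weight. *)
Definition weighted_circuit_sat (t d : nat) : pproblem := fun x k =>
  exists C : circuit,
  [/\ x = circuit_code C, wf_circuit C, weft C <= t, depth C <= d &
      exists2 a : (ninputs C).-tuple bool,
        count id a = k & circuit_value a = true].

Definition W (t : nat) (P : pproblem) : Prop :=
  exists d : nat, fpt_reducible P (weighted_circuit_sat t d).

(* 1^m 0 1^n 0 followed by the entries in row-major order. *)
Definition matrix_code (m n : nat) (H : 'M['F_2]_(m, n)) : seq bool :=
  unary m ++ unary n ++
  [seq H i j == 1%R | i <- enum 'I_m, j <- enum 'I_n].

(* Sets of columns are sets of column indices, so that equal columns at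
   different positions count separately. The cardinality conditions
   [#|S| >= n - k] and [#|S| = n - k] are stated additively because subtraction
   on [nat] is truncated: for [k > n] there is no set of exactly [n - k]
   columns. *)
Definition dual_minimum_distance : pproblem := fun x k =>
  exists (m n : nat) (H : 'M['F_2]_(m, n)),
    x = matrix_code H /\
    exists S : {set 'I_n},
      [/\ S != set0, n <= #|S| + k & (\sum_(j in S) col j H = 0)%R].

Definition dual_weight_distribution : pproblem := fun x k =>
  exists (m n : nat) (H : 'M['F_2]_(m, n)),
    x = matrix_code H /\
    exists S : {set 'I_n},
      #|S| + k = n /\ (\sum_(j in S) col j H = 0)%R.

Lemma unary_inj (a b : nat) (s t : seq bool) :
  unary a ++ s = unary b ++ t -> a = b /\ s = t.
Proof.
elim: a b => [|a IH] [|b] //=; first by case.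
by case=> /IH[-> ->].
Qed.

Lemma wires_code_inj (l l' : seq nat) (s t : seq bool) :
  wires_code l ++ s = wires_code l' ++ t -> l = l' /\ s = t.
Proof.
rewrite /wires_code !cat_rcons.
elim: l l' => [|a l IH] [|b l'] //=; first by case.
by case; rewrite -!catA => /unary_inj[-> /IH[-> ->]].
Qed.

Lemma circuit_code_inj : injective circuit_code.
Proof.
case=> n gs [n' gs']; rewrite /circuit_code /= => /unary_inj[-> E].
congr Circuit; elim: gs gs' E => [|g gs IH] [|g' gs'] //=.
- by case: g'.
- by case: g.
case: g g' => [a|l|l] [b|l'|l'] //=; case.
- by move=> /unary_inj[-> /IH->].
- by move=> /wires_code_inj[-> /IH->].
- by move=> /wires_code_inj[-> /IH->].
Qed.

Lemma matrix_code_dim (m n m' n' : nat) (H : 'M['F_2]_(m, n))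
    (H' : 'M['F_2]_(m', n')) :
  matrix_code H = matrix_code H' -> m = m' /\ n = n'.
Proof. by move=> /unary_inj[? /unary_inj[? _]]. Qed.

Lemma matrix_code_inj (m n : nat) : injective (@matrix_code m n).
Proof.
move=> H H' /unary_inj[_ /unary_inj[_ +]].
have F2 (a b : 'F_2) : (a == 1%R) = (b == 1%R) -> a = b.
  move=> E; apply: val_inj; move: E; rewrite -!val_eqE.
  by case: a b => [[|[|a]] Ha] [[|[|b]] Hb].
rewrite /allpairs => E; apply/matrixP => i j; apply: F2.
have : shape [seq [seq H i j == 1%R | j <- enum 'I_n] | i <- enum 'I_m]
     = shape [seq [seq H' i j == 1%R | j <- enum 'I_n] | i <- enum 'I_m].
  by rewrite /shape -!map_comp; apply: eq_map => r /=; rewrite !size_map.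
move=> /(eq_from_flatten_shape E) /eq_in_map /(_ i).
by rewrite mem_enum => /(_ isT) /eq_in_map /(_ j); rewrite mem_enum; apply.
Qed.

(* Main.v *)
Require Import Defs.
From mathcomp Require Import all_boot all_order all_algebra.
From mathcomp Require Import zify.

(* Both problems reduce to hitting set, that is, to a monotone CNF, which is a
   circuit of depth and weft 2. Let [T] be the complement of the sought set [S] of
   columns. Use [k + 1] blocks of [n + 1] inputs, one block for each element of
   [T] and one more to pick a member of [S] in the minimum distance problem. Input
   [j] of a block says that it picks column [j], and input [n] that it picks none.
   Ask for weight [k + 1] and, by one clause each, for every block to be non-empty,
   so that every block picks exactly one input. Two picks
   are different if for every column [j] one of them is not [j], which is a
   positive clause. Finally the columns of [S] sum to zero iff every row has the
   same parity on [T] as on all columns; for a fixed row this excludes [2 ^ (k - 1)]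
   patterns of values on the picks, and to differ from a pattern is again a
   positive clause, since "block [i] picks a column whose entry is not [b]" is a
   disjunction of inputs.

   To show that the reduction runs in FPT time, we use streams of bits and numbers
   computed in polynomial time from the input, its length and [2 ^ k] by machines
   with unary counters. These are closed under bounded sums and concatenations, so
   that no machine for the reduction has to be written down. *)

Set Implicit Arguments.
Unset Strict Implicit.
Unset Printing Implicit Defensive.

(** * Structured Turing machines *)

Local Notation sym := (cell void).
Local Notation store := (nat -> tape void).

Definition upd A (f : nat -> A) i a := fun j => if j == i then a else f j.

Lemma updE A (f : nat -> A) i a : upd f i a i = a.
Proof. by rewrite /upd eqxx. Qed.

Lemma updN A (f : nat -> A) i a j : j != i -> upd f i a j = f j.
Proof. by rewrite /upd => /negbTE->. Qed.

(* A machine that looks at a single tape in every step. Its tapes are numbered by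
   arbitrary naturals: tape 0 is the output and tape 1 the input. *)
Record prog := Prog {
  pstate : finType;
  pstart : pstate;
  pact : pstate -> option (nat * (sym -> pstate * sym * dir))
}.

(* The store after a step is only determined up to extensional equality, so that
   a step that changes nothing leads back to the same store. *)
Inductive exec (P : prog) : pstate P -> store -> nat -> store -> Prop :=
| exec_halt q T of pact q = None : exec q T 0 T
| exec_step q T i f q' w d T1 t T' of pact q = Some (i, f)
    & f (cur (T i)) = (q', w, d)
    & T1 =1 upd T i (move d (write w (T i)))
    & exec q' T1 t T' : exec q T t.+1 T'.

(** At least 1, so that input and output have two different tapes even if no state accesses them. *)
Definition ptapes (P : prog) : nat :=
  maxn 1 (\max_(q : pstate P) (if pact q is Some (i, _) then i else 0)).

Lemma pact_ptapes (P : prog) (q : pstate P) i f :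
  pact q = Some (i, f) -> i <= ptapes P.
Proof.
move=> E; rewrite /ptapes leq_max; apply/orP; right.
by apply: leq_trans (leq_bigmax q); rewrite E.
Qed.

(* [machine] has its input on the first tape and its output on the last one. *)
Definition slot N i : 'I_N.+1 := if i is j.+1 then inord j else ord_max.

Lemma slot_inj N i j : i <= N -> j <= N -> slot N i = slot N j -> i = j.
Proof.
case: i j => [|i] [|j] //= Hi Hj /(congr1 val) /=; rewrite ?inordK //; lia.
Qed.

Definition tm (P : prog) : machine :=
  @Machine void (pstate P) (pstart P) (ptapes P) (fun q c =>
    if pact q is Some (i, f) then
      let: (q', w, d) := f (c (slot _ i)) in
      Some (q', [ffun j => if j == slot _ i then (w, d) else (c j, Stay)])
    else None).

(** A halted configuration is a fixed point of [run], so an upper bound [t'] on the number of steps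
    is as good as the exact number. *)
Lemma exec_run (P : prog) q T t T' (c : config (tm P)) t' :
    exec q T t T' -> t <= t' -> c.1 = q ->
    (forall i, i <= ptapes P -> c.2 (slot _ i) = T i) ->
  step (run t' c) = None /\
  forall i, i <= ptapes P -> (run t' c).2 (slot _ i) = T' i.
Proof.
move=> X; elim: X c t' => {q T t T'} [q T Eq|q T i f q' w d T1 t T' Eq Ef ET _ IH].
  move=> c t' _ Ec Hc.
  have S : step c = None by rewrite /step /= Ec Eq.
  by case: t' => [|t'] /=; rewrite ?S.
case=> q0 tp [//|t'] /= lt_t Ec Hc; subst q0.
have Hi := pact_ptapes Eq.
rewrite /step /= Eq ffunE /= Hc // Ef /=.
apply: IH => //= j Hj; rewrite !ffunE ET /upd.
have -> : (slot (ptapes P) j == slot _ i) = (j == i).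
  by apply/eqP/eqP => [/slot_inj->|->].
by case: eqP => [->|_] /=; rewrite Hc //; case: (T j).
Qed.

Definition init_store (x : seq bool) : store :=
  fun i => if i == 1 then input_tape void x else Tape [::] None [::].

Lemma exec_outputs_within (P : prog) x t T' t' :
    exec (pstart P) (init_store x) t T' -> t <= t' ->
  outputs_within (tm P) x t' (read_bits (cur (T' 0) :: right (T' 0))).
Proof.
move=> X le_t; have := @exec_run P _ _ _ _ (init (tm P) x) t' X le_t erefl.
case=> [[|i] Hi|S Ht].
- rewrite /= ffunE /init_store; case: eqP => // /(congr1 val) /=.
  by rewrite /ptapes; lia.
- rewrite /= ffunE /init_store -val_eqE /= inordK; last by lia.
  by case: i Hi.
by rewrite /outputs_within; split=> //; rewrite /output -(Ht 0).
Qed.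

(** * Hoare triples with time bounds, and control structures *)

Definition hoare (Pre : store -> Prop) (A : prog) t (Post : store -> Prop) :=
  forall T, Pre T ->
  exists T' t', [/\ exec (pstart A) T t' T', t' <= t & Post T'].

(** For running a component inside a composite program: the image of its halting state need not halt
    there, so the execution is left open for a continuation of [u] steps. *)
Lemma exec_embed (A P : prog) (h : pstate A -> pstate P) q T t T' :
    (forall q i f, pact q = Some (i, f) -> exists g,
       pact (h q) = Some (i, g) /\
       forall c, g c = (h (f c).1.1, (f c).1.2, (f c).2)) ->
    exec q T t T' ->
  exists q', pact q' = None /\
    forall u T'', exec (h q') T' u T'' -> exec (h q) T (t + u) T''.
Proof.
move=> Hh; elim=> {q T t T'} [q T Eq|q T i f q' w d T1 t T' Eq Ef ET _ [r [Er Hr]]].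
  by exists q.
exists r; split=> // u T'' /Hr X.
have [g [Eg Hg]] := Hh _ _ _ Eq.
by apply: exec_step Eg _ ET X; rewrite Hg Ef.
Qed.

Lemma upd_noop (T : store) i :
  T =1 upd T i (move Stay (write (cur (T i)) (T i))).
Proof. by move=> j; rewrite /upd; case: eqP => // ->; case: (T i). Qed.

Definition atom i w d : prog :=
  @Prog bool false (fun q =>
    if q then None else Some (i, fun c => (true, w c, d))).

Lemma hoare_atom (Pre Post : store -> Prop) i w d :
    (forall T, Pre T -> Post (upd T i (move d (write (w (cur (T i))) (T i))))) ->
  hoare Pre (atom i w d) 1 Post.
Proof.
move=> H T /H HT; eexists; exists 1; split=> //; last exact: HT.
by apply: exec_step => //=; apply: exec_halt.
Qed.

Definition pseq (A B : prog) : prog :=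
  @Prog (pstate A + pstate B)%type (inl (pstart A)) (fun q =>
    match q with
    | inl a =>
      if pact a is Some (i, f)
      then Some (i, fun c => (inl (f c).1.1, (f c).1.2, (f c).2))
      else Some (0, fun c => (inr (pstart B), c, Stay))
    | inr b =>
      if pact b is Some (i, f)
      then Some (i, fun c => (inr (f c).1.1, (f c).1.2, (f c).2))
      else None
    end).

(** The additional step is the handover, which rewrites the scanned cell of tape 0 and changes no
    tape. *)
Lemma hoare_seq P Q R A B t u :
    hoare P A t Q -> hoare Q B u R -> hoare P (pseq A B) (t + u + 1) R.
Proof.
move=> HA HB T /HA[T1 [t1 [X1 le1 /HB[T2 [t2 [X2 le2 HT2]]]]]].
exists T2, (t1 + (t2 + 0).+1); split=> //; last by lia.
have [q|q [Eq H1]] := @exec_embed A (pseq A B) inl _ _ _ _ _ X1.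
  by move=> i f E; eexists; split; first by rewrite /= E.
have [q'|q' [Eq' H2]] := @exec_embed B (pseq A B) inr _ _ _ _ _ X2.
  by move=> i f E; eexists; split; first by rewrite /= E.
apply: H1; apply: exec_step (upd_noop T1 0) _ => /=; first by rewrite Eq.
  by [].
by apply: H2; apply: exec_halt; rewrite /= Eq'.
Qed.

Definition pif i (p : pred sym) (A B : prog) : prog :=
  @Prog (option (pstate A + pstate B))%type None (fun q =>
    match q with
    | None => Some (i, fun c =>
        (Some (if p c then inl (pstart A) else inr (pstart B)), c, Stay))
    | Some (inl a) =>
      if pact a is Some (i, f)
      then Some (i, fun c => (Some (inl (f c).1.1), (f c).1.2, (f c).2))
      else None
    | Some (inr b) =>
      if pact b is Some (i, f)
      then Some (i, fun c => (Some (inr (f c).1.1), (f c).1.2, (f c).2))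
      else None
    end).

Lemma hoare_if (Pre Post : store -> Prop) i (p : pred sym) A B t :
    hoare (fun T => Pre T /\ p (cur (T i))) A t Post ->
    hoare (fun T => Pre T /\ ~~ p (cur (T i))) B t Post ->
  hoare Pre (pif i p A B) t.+1 Post.
Proof.
move=> HA HB T HT; case Ep: (p (cur (T i))).
  have [|T1 [t1 [X1 le1 H1]]] := HA T; first by [].
  exists T1, (t1 + 0).+1; split=> //; last by lia.
  have [q|q [Eq H2]] := @exec_embed A (pif i p A B) (Some \o inl) _ _ _ _ _ X1.
    by move=> j f E; eexists; split; first by rewrite /= E.
  apply: exec_step (upd_noop T i) _ => //=; rewrite Ep.
  by apply: H2; apply: exec_halt; rewrite /= Eq.
have [|T1 [t1 [X1 le1 H1]]] := HB T; first by rewrite Ep.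
exists T1, (t1 + 0).+1; split=> //; last by lia.
have [q|q [Eq H2]] := @exec_embed B (pif i p A B) (Some \o inr) _ _ _ _ _ X1.
  by move=> j f E; eexists; split; first by rewrite /= E.
apply: exec_step (upd_noop T i) _ => //=; rewrite Ep.
by apply: H2; apply: exec_halt; rewrite /= Eq.
Qed.

Definition pwhile i (p : pred sym) (A : prog) : prog :=
  @Prog (option (option (pstate A))) None (fun q =>
    match q with
    | None => Some (i, fun c =>
        (Some (if p c then Some (pstart A) else None), c, Stay))
    | Some None => None
    | Some (Some a) =>
      if pact a is Some (i, f)
      then Some (i, fun c => (Some (Some (f c).1.1), (f c).1.2, (f c).2))
      else Some (0, fun c => (None, c, Stay))
    end).

(** The invariant is indexed by the number of finished rounds. A round costs two steps more than its
    body: the test and the jump back to it. *)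
Lemma hoare_while (I : nat -> store -> Prop) n i (p : pred sym) A t :
    (forall j T, j < n -> I j T -> p (cur (T i))) ->
    (forall T, I n T -> ~~ p (cur (T i))) ->
    (forall j, j < n -> hoare (I j) A t (I j.+1)) ->
  hoare (I 0) (pwhile i p A) (n * (t + 2) + 1) (I n).
Proof.
move=> Hp Hn HA.
have: forall m, m <= n -> hoare (I (n - m)) (pwhile i p A) (m * (t + 2) + 1) (I n).
  elim=> [|m IH] le_m T HT.
    rewrite subn0 in HT; exists T, 1; split=> //.
    apply: exec_step (upd_noop T i) _ => //=.
    by rewrite (negbTE (Hn _ HT)); apply: exec_halt.
  have lt_m : n - m.+1 < n by lia.
  have [T1 [t1 [X1 le1 H1]]] := HA _ lt_m T HT.
  have Em : (n - m.+1).+1 = n - m by lia.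
  rewrite Em in H1.
  have [T2 [t2 [X2 le2 H2]]] := IH (ltnW le_m) _ H1.
  exists T2, (t1 + t2.+1).+1; split=> //; last first.
    by rewrite mulSn; lia.
  have [q|q [Eq HX]] := @exec_embed A (pwhile i p A) (Some \o Some) _ _ _ _ _ X1.
    by move=> j f E; eexists; split; first by rewrite /= E.
  apply: exec_step (upd_noop T i) _ => //=; rewrite (Hp _ _ lt_m HT).
  apply: HX; apply: exec_step (upd_noop T1 0) X2 => /=; first by rewrite Eq.
  by [].
by move=> /(_ n (leqnn n)); rewrite subnn.
Qed.

Lemma hoare_weaken (P Q P' Q' : store -> Prop) A t t' :
    (forall T, P' T -> P T) -> (forall T, Q T -> Q' T) -> t <= t' ->
  hoare P A t Q -> hoare P' A t' Q'.
Proof.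
move=> HP HQ le_t H T /HP/H[T' [u [X le_u /HQ HT]]].
by exists T', u; split=> //; apply: leq_trans le_t.
Qed.

(** * Counters, input head and output stream *)

(* The counter cells carry [v] ones right of a blank, the head on the last of them. *)
Definition one : sym := Some (inl true).

Definition counts (t : tape void) (v : nat) : Prop :=
  exists l, cur t :: left t = nseq v one ++ None :: l.

Definition bits_cells (s : seq bool) : seq sym := [seq Some (inl b) | b <- s].

(** The tape before the input is unconstrained, as [triple_left] starts from a positive position;
    the default [None] of [nth] makes the tape blank behind the input. *)
Definition reads (t : tape void) (z : seq bool) (p : nat) : Prop :=
  (forall i, i < p -> nth None (left t) i = nth None (bits_cells z) (p - i.+1)) /\
  (forall i, nth None (cur t :: right t) i = nth None (bits_cells z) (p + i)).

Record conf := Conf { reg : nat -> nat; pos : nat; out : seq bool }.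

Definition rep (z : seq bool) (s : conf) (T : store) : Prop :=
  [/\ T 0 = Tape (rev (bits_cells (out s))) None [::],
      reads (T 1) z (pos s) &
      forall i, counts (T i.+2) (reg s i)].

Definition triple z s A t s' := hoare (rep z s) A t (rep z s').

Lemma triple_weaken z s A t s' s0 u s1 :
    triple z s A t s' -> out s0 = out s -> pos s0 = pos s -> reg s0 =1 reg s ->
    out s' = out s1 -> pos s' = pos s1 -> reg s' =1 reg s1 -> t <= u ->
  triple z s0 A u s1.
Proof.
move=> H Eo Ep Ev Eo1 Ep1 Ev1 le_t; apply: hoare_weaken le_t H.
  by move=> T [? ? H]; split; rewrite -?Eo -?Ep // => i; rewrite -Ev.
by move=> T [? ? H]; split; rewrite -?Eo1 -?Ep1 // => i; rewrite -Ev1.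
Qed.

Lemma triple_post z s A t s' u s1 :
    triple z s A t s' -> out s' = out s1 -> pos s' = pos s1 ->
    reg s' =1 reg s1 -> t <= u ->
  triple z s A u s1.
Proof. by move=> H ? ? ? ?; apply: triple_weaken H _ _ _ _ _ _ _. Qed.

Lemma triple_seq z s s' s'' A B t u :
    triple z s A t s' -> triple z s' B u s'' ->
  triple z s (pseq A B) (t + u + 1) s''.
Proof. exact: hoare_seq. Qed.

Definition istrue (c : sym) : bool := if c is Some (inl b) then b else false.

Lemma rep_nz z s T i : rep z s T -> isSome (cur (T i.+2)) = (0 < reg s i).
Proof. by case=> _ _ /(_ i)[l]; case: (reg s i) => [|v] [->]. Qed.

Lemma rep_cur z s T : rep z s T -> cur (T 1) = nth None (bits_cells z) (pos s).
Proof. by case=> _ [_ /(_ 0)] /=; rewrite addn0. Qed.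

Lemma rep_istrue z s T : rep z s T -> istrue (cur (T 1)) = nth false z (pos s).
Proof.
move=> /rep_cur->; have [lt|ge] := ltnP (pos s) (size z).
  by rewrite (nth_map false).
by rewrite !nth_default ?size_map.
Qed.

Lemma rep_nonblank z s T : rep z s T -> isSome (cur (T 1)) = (pos s < size z).
Proof.
move=> /rep_cur->; have [lt|ge] := ltnP (pos s) (size z).
  by rewrite (nth_map false).
by rewrite !nth_default ?size_map.
Qed.

Definition loop i A := pwhile i.+2 isSome A.

Lemma triple_loop z i A (S : nat -> conf) n t :
    (forall j, j < n -> 0 < reg (S j) i) -> reg (S n) i = 0 ->
    (forall j, j < n -> triple z (S j) A t (S j.+1)) ->
  triple z (S 0) (loop i A) (n * (t + 2) + 1) (S n).
Proof.
move=> H1 H2 H3; apply: (@hoare_while (fun j => rep z (S j))) => //.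
  by move=> j T lt_j /rep_nz->; apply: H1.
by move=> T /rep_nz->; rewrite H2.
Qed.

Definition ifnz i A B := pif i.+2 isSome A B.

Lemma triple_ifnz z i A B s s' t :
    (0 < reg s i -> triple z s A t s') -> (reg s i = 0 -> triple z s B t s') ->
  triple z s (ifnz i A B) t.+1 s'.
Proof.
move=> HA HB; apply: hoare_if => T [HT]; rewrite (rep_nz _ HT).
  by move=> /HA H; apply: H.
by rewrite -eqn0Ngt => /eqP/HB H; apply: H.
Qed.

(** The cell to the right may hold a [one] left behind by [dec]; [counts] says nothing about it, so
    it is overwritten. *)
Definition inc i :=
  pseq (atom i.+2 id Right) (atom i.+2 (fun=> one) Stay).

Lemma triple_inc z v p o i :
  triple z (Conf v p o) (inc i) 3 (Conf (upd v i (v i).+1) p o).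
Proof.
(* Between the two steps the head of counter [i] scans an unknown cell, with the ones to its
   left. *)
pose Q (T : store) := [/\ T 0 = Tape (rev (bits_cells o)) None [::], reads (T 1) z p &
  forall j, if j == i then exists l, left (T j.+2) = nseq (v i) one ++ None :: l
            else counts (T j.+2) (v j)].
apply: (@hoare_seq _ Q _ _ _ 1 1).
  apply: hoare_atom => T [H0 H1 H2]; split; rewrite ?updN //.
  move=> j; have [->|N] := eqVneq j i; last by rewrite updN.
  rewrite updE /=; by have [l El] := H2 i; exists l.
apply: hoare_atom => T [H0 H1 H2]; split; rewrite ?updN //.
move=> j; have := H2 j; have [->|N] := eqVneq j i; last by rewrite /= !updN.
rewrite /= !updE; by case=> l El; exists l; rewrite /= El.
Qed.

Definition dec i := atom i.+2 id Left.

Lemma triple_dec z v p o i : 0 < v i ->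
  triple z (Conf v p o) (dec i) 1 (Conf (upd v i (v i).-1) p o).
Proof.
move=> v_gt0; apply: hoare_atom => T [H0 H1 H2]; split; rewrite ?updN //= => j.
have := H2 j; have [->|N] := eqVneq j i; last by rewrite !updN.
rewrite !updE /=; case: (v i) v_gt0 => //= w _ [l /= [_ ->]]; exists l.
by case: w.
Qed.

Definition right_in := atom 1 id Right.
Definition left_in := atom 1 id Left.

Lemma triple_right z v p o :
  triple z (Conf v p o) right_in 1 (Conf v p.+1 o).
Proof.
apply: hoare_atom => T [H0 [H1 H1'] H2].
split; [by [] | rewrite /= updE | by []].
case: (T 1) H1 H1' => l c r /= H1 H1'; split=> /= [[|i] lt_i|i] /=.
- by have := H1' 0; rewrite addn0 subn1.
- by rewrite H1 //; congr nth; lia.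
- have := H1' i.+1; rewrite addnS addSn /= => <-.
  by case: r {H1'} => [|a r]; case: i => //= i; rewrite nth_nil.
Qed.

Lemma triple_left z v p o :
  triple z (Conf v p.+1 o) left_in 1 (Conf v p o).
Proof.
apply: hoare_atom => T [H0 [H1 H1'] H2].
split; [by [] | rewrite /= updE | by []].
case: (T 1) H1 H1' => l c r /= H1 H1'; split=> /= [i lt_i|[|i]] /=.
- by rewrite nth_behead H1 //; congr nth; lia.
- by rewrite -nth0 H1 // addn0 subn1.
by rewrite H1'; congr nth; lia.
Qed.

Definition emit b := atom 0 (fun=> Some (inl b)) Right.

Lemma triple_emit z v p o b :
  triple z (Conf v p o) (emit b) 1 (Conf v p (rcons o b)).
Proof.
apply: hoare_atom => T [H0 H1 H2]; split=> //=; rewrite updE H0 /=.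
by rewrite /bits_cells map_rcons rev_rcons.
Qed.

(** * Polynomial-time functions and bit streams *)

Ltac regs := rewrite /= /upd; do ?[case: eqP => ?]; subst; try lia.
Ltac cells := move=> ?; regs.

Definition clear i := loop i (dec i).

Lemma triple_clear z v p o i :
  triple z (Conf v p o) (clear i) (v i * 3 + 1) (Conf (upd v i 0) p o).
Proof.
apply: triple_weaken (@triple_loop z i (dec i)
  (fun j => Conf (upd v i (v i - j)) p o) (v i) 1 _ _ _) _ _ _ _ _ _ _ => //=.
- by move=> j lt_j; rewrite updE; lia.
- by rewrite updE subnn.
- move=> j lt_j; apply: triple_post (triple_dec _) _ _ _ _ => //=.
    by rewrite updE; lia.
  by cells.
- by cells.
- by cells.
Qed.

Definition transfer i j := loop i (pseq (dec i) (inc j)).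

Lemma triple_transfer z v p o i j : i != j ->
  triple z (Conf v p o) (transfer i j) (v i * 7 + 1)
    (Conf (upd (upd v j (v j + v i)) i 0) p o).
Proof.
move=> /eqP ne; apply: triple_weaken (@triple_loop z i _
  (fun k => Conf (upd (upd v j (v j + k)) i (v i - k)) p o) (v i) 5 _ _ _)
  _ _ _ _ _ _ _ => //=.
- by move=> k lt_k; rewrite updE; lia.
- by rewrite updE subnn.
- move=> k lt_k; apply: triple_post (triple_seq (triple_dec _)
    (triple_inc _)) _ _ _ _ => //=.
    by rewrite updE; lia.
  by cells.
- by cells.
- by cells.
Qed.

(** Counting [t] down destroys it, so its value goes to the scratch counter [j] as well, from which
    it is restored. *)
Definition copy t i j :=
  pseq (loop t (pseq (dec t) (pseq (inc i) (inc j)))) (transfer j t).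

Lemma triple_copy z v p o t i j : t != i -> t != j -> i != j -> v i = 0 -> v j = 0 ->
  triple z (Conf v p o) (copy t i j) (v t * 18 + 3) (Conf (upd v i (v t)) p o).
Proof.
move=> /eqP ne1 /eqP ne2 /eqP ne3 vi vj.
pose S k := Conf (upd (upd (upd v i k) j k) t (v t - k)) p o.
have H1 : triple z (S 0) (loop t (pseq (dec t) (pseq (inc i) (inc j))))
    (v t * 11 + 1) (S (v t)).
  apply: (@triple_loop z t _ S (v t) 9) => /=.
  - by move=> k lt_k; rewrite updE; lia.
  - by rewrite updE subnn.
  move=> k lt_k; apply: triple_post (triple_seq (triple_dec _)
    (triple_seq (triple_inc _) (triple_inc _)))
     _ _ _ _ => //=.
    by rewrite updE; lia.
  by cells.
apply: triple_weaken (triple_seq H1 (triple_transfer _)) _ _ _ _ _ _ _ => //=.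
- by apply/eqP; lia.
- by cells.
- by cells.
by regs.
Qed.

(** The base [B + 2] is at least 2, so that constants and sums are absorbed by a larger exponent. *)
Definition polyb (f : nat -> nat) :=
  {homo f : x y / x <= y} /\ exists D, forall B, f B <= (B + 2) ^ D.

Lemma polyb_id : polyb id.
Proof. by split=> //; exists 1 => B; rewrite expn1 leq_addr. Qed.

Lemma leq_pow_add2 B D D' : D <= D' -> (B + 2) ^ D <= (B + 2) ^ D'.
Proof. by move=> le_D; rewrite leq_exp2l //; lia. Qed.

Lemma polyb_const c : polyb (fun=> c).
Proof.
split=> //; exists c => B; apply: leq_trans (ltnW (ltn_expl c (ltnSn 1))) _.
by case: c => // c; rewrite leq_exp2r //; lia.
Qed.

Lemma polyb_add f g : polyb f -> polyb g -> polyb (fun B => f B + g B).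
Proof.
move=> [mf [Df Hf]] [mg [Dg Hg]]; split=> [x y le_xy|].
  by rewrite leq_add ?mf ?mg.
exists (Df + Dg).+1 => B; rewrite expnS.
have := leq_trans (Hf B) (leq_pow_add2 B (leq_addr Dg Df)).
have := leq_trans (Hg B) (leq_pow_add2 B (leq_addl Df Dg)).
by nia.
Qed.

Lemma polyb_mul f g : polyb f -> polyb g -> polyb (fun B => f B * g B).
Proof.
move=> [mf [Df Hf]] [mg [Dg Hg]]; split=> [x y le_xy|].
  by rewrite leq_mul ?mf ?mg.
by exists (Df + Dg) => B; rewrite expnD leq_mul.
Qed.

Lemma polyb_comp f g : polyb f -> polyb g -> polyb (fun B => f (g B)).
Proof.
move=> [mf [Df Hf]] [mg [Dg Hg]]; split=> [x y le_xy|].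
  by rewrite mf ?mg.
exists (Dg.+2 * Df) => B; apply: leq_trans (Hf _) _.
rewrite expnM; case: Df {Hf} => // Df; rewrite leq_exp2r // !expnS.
have := Hg B; have : 0 < (B + 2) ^ Dg by rewrite expn_gt0; lia.
by nia.
Qed.

Ltac polyb := repeat first [assumption | exact: polyb_id | exact: polyb_const
  | apply: polyb_add | apply: polyb_mul
  | match goal with H : polyb ?f |- polyb (fun B => ?f (@?g B)) =>
      apply: (@polyb_comp f g H) end].

(** The counters from [d] on start out as zero and can therefore serve as scratch space. *)
Definition fits (rho : seq nat) d (v : nat -> nat) (vals : seq nat) :=
  [/\ map v rho = vals, all (fun i => i < d) rho & forall i, d <= i -> v i = 0].

Lemma fits_above rho d v vals d' w : fits rho d v vals -> d <= d' ->
  (forall i, i < d -> w i = v i) -> (forall i, d' <= i -> w i = 0) ->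
  fits rho d' w vals.
Proof.
move=> [<- /allP Hd Hz] le_d Hw Hw'; split=> //.
  by apply/eq_in_map => i /Hd; apply: Hw.
by apply/allP => i /Hd /=; lia.
Qed.

Lemma fits_cons rho d v vals d' w t : fits rho d v vals -> d <= t < d' ->
  (forall i, i < d -> w i = v i) -> (forall i, d' <= i -> w i = 0) ->
  fits (t :: rho) d' w (w t :: vals).
Proof.
move=> Hf /andP[le_t lt_t] Hw Hw'.
have [|<- Ha ?] := fits_above Hf _ Hw Hw'; first by lia.
by split=> //=; rewrite lt_t Ha.
Qed.

Section Class.

Variables (X : Type) (inp : X -> seq bool) (vars : seq (X -> nat)).

(* [F] is computed in polynomial time from the input and the values of [vars];
   [M rho d] expects the latter on the counters [rho], all below [d], and puts the
   result on counter [d], using the counters above [d] as scratch space. *)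
Definition cfun (F : X -> nat) := exists (M : seq nat -> nat -> prog) (b : nat -> nat),
  polyb b /\ forall rho d v o x B,
    fits rho d v [seq f x | f <- vars] -> size (inp x) <= B ->
    all (fun f => f x <= B) vars ->
    F x <= b B /\
    triple (inp x) (Conf v 0 o) (M rho d) (b B) (Conf (upd v d (F x)) 0 o).

Definition cgen (F : X -> seq bool) := exists (M : seq nat -> nat -> prog) (b : nat -> nat),
  polyb b /\ forall rho d v o x B,
    fits rho d v [seq f x | f <- vars] -> size (inp x) <= B ->
    all (fun f => f x <= B) vars ->
    size (F x) <= b B /\
    triple (inp x) (Conf v 0 o) (M rho d) (b B) (Conf v 0 (o ++ F x)).

End Class.

(** A bound variable is paired with the input and put in front of the others, as with de Bruijn
    indices. *)
Definition vars' X (vars : seq (X -> nat)) : seq (X * nat -> nat) :=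
  snd :: [seq (fun p => f p.1) | f <- vars].

(** * Closure under sums, iteration, input access, branching and loops *)

Section Closure.

Variables (X : Type) (inp : X -> seq bool) (vars : seq (X -> nat)).
Local Notation cfun' F :=
  (cfun (fun p : X * nat => inp p.1) (vars' vars) (fun p => F p.1 p.2)).
Local Notation cgen' F :=
  (cgen (fun p : X * nat => inp p.1) (vars' vars) (fun p => F p.1 p.2)).
Local Notation cfun := (cfun inp vars).
Local Notation cgen := (cgen inp vars).

Lemma eq_cfun F G : F =1 G -> cfun F -> cfun G.
Proof.
move=> E [M [b [pb H]]]; exists M, b; split=> // rho d v o x B.
by rewrite -E; apply: H.
Qed.

Lemma eq_cgen F G : F =1 G -> cgen F -> cgen G.
Proof.
move=> E [M [b [pb H]]]; exists M, b; split=> // rho d v o x B.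
by rewrite -E; apply: H.
Qed.

Lemma vars'_bound x i B : i <= B -> all (fun f => f x <= B) vars ->
  all (fun f => f (x, i) <= B) (vars' vars).
Proof. by move=> le_i H; rewrite /= le_i all_map. Qed.

Lemma bound_weaken x B B' : B <= B' -> all (fun f => f x <= B) vars ->
  all (fun f => f x <= B') vars.
Proof. by move=> le_B; apply: sub_all => f /leq_trans; apply. Qed.

Lemma vars'_vals x i : [seq f (x, i) | f <- vars' vars] = i :: [seq f x | f <- vars].
Proof. by rewrite /= -map_comp. Qed.

Fixpoint incs c i := if c is c'.+1 then pseq (incs c' i) (inc i) else clear i.

Lemma triple_incs z v p o c i : v i = 0 ->
  triple z (Conf v p o) (incs c i) (c * 4 + 1) (Conf (upd v i c) p o).
Proof.
move=> vi; elim: c => [|c IH] /=.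
  by apply: triple_post (triple_clear _) _ _ _ _; rewrite ?vi.
apply: triple_post (triple_seq IH (triple_inc _)) _ _ _ _ => //=.
- by cells.
by lia.
Qed.

Lemma cfun_const c : cfun (fun=> c).
Proof.
exists (fun _ d => incs c d), (fun=> c * 4 + 1); split; first by polyb.
move=> rho d v o x B [_ _ Hz] _ _; split; first by lia.
by apply: triple_incs; apply: Hz.
Qed.

Lemma cfun_var i : i < size vars -> cfun (nth (fun=> 0) vars i).
Proof.
move=> lt_i; exists (fun rho d => copy (nth 0 rho i) d d.+1), (fun B => B * 18 + 3).
split; first by polyb.
move=> rho d v o x B [Hm Hd Hz] _ HB.
have Ev : v (nth 0 rho i) = nth (fun=> 0) vars i x.
  have sz : size rho = size vars by rewrite -(size_map v) Hm size_map.
  by rewrite -(nth_map 0 0) ?sz // Hm (nth_map (fun=> 0)).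
have le : nth (fun=> 0) vars i x <= B by move/all_nthP: HB; apply.
have lt_d : nth 0 rho i < d.
  by move/all_nthP: Hd; apply; rewrite -(size_map v) Hm size_map.
split; first by lia.
apply: triple_post (triple_copy _ _ _ _ _) _ _ _ _ => //=;
  rewrite ?Ev ?Hz //; by [lia | apply/eqP; lia].
Qed.

Lemma cfun_add F G : cfun F -> cfun G -> cfun (fun x => F x + G x).
Proof.
move=> [M1 [b1 [pb1 H1]]] [M2 [b2 [pb2 H2]]].
exists (fun rho d => pseq (M1 rho d) (pseq (M2 rho d.+1) (transfer d.+1 d))).
exists (fun B => b1 B + b2 B * 8 + 5); split; first by polyb.
move=> rho d v o x B Hf HL HB; have [_ _ Hz] := Hf.
have [le1 T1] := H1 rho d v o x B Hf HL HB.
have [|le2 T2] := H2 rho d.+1 (upd v d (F x)) o x B _ HL HB.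
  by apply: fits_above Hf _ _ _ => // i ?; have := Hz i; regs.
split; first by lia.
apply: triple_post (triple_seq T1 (triple_seq T2 (triple_transfer _)))
  _ _ _ _ => //=.
- by apply/eqP; lia.
- by move=> q; have := Hz d.+1 (leqnSn d); regs.
by regs.
Qed.

(** Subtraction is truncated: for each unit of [G] the counter [d] is decremented unless it is zero,
    when [clear] serves as a no-op. *)
Lemma cfun_sub F G : cfun F -> cfun G -> cfun (fun x => F x - G x).
Proof.
move=> [M1 [b1 [pb1 H1]]] [M2 [b2 [pb2 H2]]].
exists (fun rho d => pseq (M1 rho d) (pseq (M2 rho d.+1)
   (loop d.+1 (pseq (dec d.+1) (ifnz d (dec d) (clear d)))))).
exists (fun B => b1 B + b2 B * 10 + 5); split; first by polyb.
move=> rho d v o x B Hf HL HB; have [_ _ Hz] := Hf.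
have [le1 T1] := H1 rho d v o x B Hf HL HB.
have [|le2 T2] := H2 rho d.+1 (upd v d (F x)) o x B _ HL HB.
  by apply: fits_above Hf _ _ _ => // i ?; have := Hz i; regs.
split; first by lia.
have T3 : triple (inp x) (Conf (upd (upd v d (F x)) d.+1 (G x)) 0 o)
    (loop d.+1 (pseq (dec d.+1) (ifnz d (dec d) (clear d))))
    (G x * 9 + 1) (Conf (upd v d (F x - G x)) 0 o).
  pose S k := Conf (upd (upd v d (F x - k)) d.+1 (G x - k)) 0 o.
  apply: triple_weaken (@triple_loop (inp x) d.+1 _ S (G x) 7 _ _ _)
    _ _ _ _ _ _ _ => //=.
  - by move=> j lt_j; rewrite updE; lia.
  - by rewrite updE subnn.
  - move=> j lt_j; apply: triple_post (triple_seq (triple_dec _)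
      (@triple_ifnz _ _ _ _ _ (S j.+1) 4 _ _)) _ _ _ _ => //=.
    + by rewrite updE; lia.
    + move=> H; apply: triple_post (triple_dec H) _ _ _ _ => //=.
      by cells.
    + move=> H; apply: triple_post (triple_clear _) _ _ _ _ => //=.
        by move=> q; move: H; regs.
      by rewrite H.
  - by cells.
  - by move=> q; have := Hz d.+1 (leqnSn d); regs.
apply: triple_post (triple_seq T1 (triple_seq T2 T3)) _ _ _ _ => //=.
by lia.
Qed.

(** Counter [d] holds the partial sum, [d + 1] the number of rounds left, [d + 2] the index, which
    is the bound variable of [G], and [d + 3] the current summand. Index and old variables are
    bounded by [B + b1 B]. *)
Lemma cfun_sum (F : X -> nat) (G : X -> nat -> nat) : cfun F -> cfun' G ->
  cfun (fun x => \sum_(i < F x) G x i).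
Proof.
move=> [M1 [b1 [pb1 H1]]] [M2 [b2 [pb2 H2]]].
exists (fun rho d => pseq (M1 rho d.+1) (pseq (loop d.+1
  (pseq (M2 (d.+2 :: rho) d.+3) (pseq (transfer d.+3 d) (pseq (inc d.+2) (dec d.+1)))))
  (clear d.+2))).
exists (fun B => b1 B + b1 B * (b2 (B + b1 B) * 9 + 20) + 10); split; first by polyb.
move=> rho d v o x B Hf HL HB; have [_ _ Hz] := Hf.
have [|le1 T1] := H1 rho d.+1 v o x B _ HL HB.
  by apply: fits_above Hf _ _ _ => // i ?; have := Hz i; lia.
(* The specification of [G] bounds its value only in the presence of a fitting store, so one with
   the index on counter [d] is exhibited. *)
have HG i : i < F x -> G x i <= b2 (B + b1 B).
  move=> lt_i; pose w := upd v d i.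
  have [|||//] := H2 (d :: rho) d.+1 w o (x, i) (B + b1 B).
  - rewrite vars'_vals; have -> : i = w d by rewrite /w updE.
    by apply: (fits_cons Hf) => [|j ?|j ?]; first lia; have := Hz j; rewrite /w; regs.
  - by rewrite /=; lia.
  - by apply: vars'_bound (bound_weaken _ HB) => /=; lia.
have le_sum : \sum_(i < F x) G x i <= b1 B * b2 (B + b1 B).
  apply: leq_trans (_ : \sum_(i < F x) b2 (B + b1 B) <= _).
    by apply: leq_sum => i _; apply: HG.
  by rewrite sum_nat_const card_ord leq_mul2r le1 orbT.
split; first by nia.
pose S k := Conf (upd (upd (upd v d (\sum_(i < k) G x i)) d.+1 (F x - k)) d.+2 k) 0 o.
have T2 : triple (inp x) (Conf (upd v d.+1 (F x)) 0 o) (loop d.+1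
    (pseq (M2 (d.+2 :: rho) d.+3) (pseq (transfer d.+3 d) (pseq (inc d.+2) (dec d.+1)))))
    (F x * (b2 (B + b1 B) * 8 + 10) + 1) (S (F x)).
  apply: triple_weaken (@triple_loop (inp x) d.+1 _ S (F x)
    (b2 (B + b1 B) * 8 + 8) _ _ _) _ _ _ _ _ _ _ => //=.
  - by move=> j lt_j; regs.
  - by regs.
  - move=> j lt_j.
    have [|||le2 T2] := H2 (d.+2 :: rho) d.+3 (reg (S j)) o (x, j) (B + b1 B).
    + have E : reg (S j) d.+2 = j by regs.
      rewrite vars'_vals -[X in fits _ _ _ (X :: _)]E.
      by apply: (fits_cons Hf) => [|i ?|i ?]; first lia; have := Hz i; regs.
    + by rewrite /=; lia.
    + by apply: vars'_bound (bound_weaken _ HB) => /=; lia.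
    apply: triple_post (triple_seq T2 (triple_seq (triple_transfer _)
      (triple_seq (triple_inc _) (triple_dec _)))) _ _ _ _ => //=.
    + by regs.
    + by regs.
    + by move=> q; have := Hz q; rewrite big_ord_recr /=; regs.
    + by have := HG _ lt_j; regs.
  - by move=> q; rewrite big_ord0; have := Hz q; regs.
  - by lia.
apply: triple_post (triple_seq T1 (triple_seq T2 (triple_clear _))) _ _ _ _ => //=.
  by move=> q; have := Hz q; regs.
by regs; nia.
Qed.

(** While the head walks to position [F x], counter [d + 2] records the way back. Beyond the input
    it scans a blank, for which [istrue] yields the default [false] of [nth]. *)
Lemma cfun_read F : cfun F -> cfun (fun x => nth false (inp x) (F x)).
Proof.
move=> [M1 [b1 [pb1 H1]]].
exists (fun rho d => pseq (M1 rho d.+1)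
  (pseq (loop d.+1 (pseq (dec d.+1) (pseq (inc d.+2) right_in)))
  (pseq (pif 1 istrue (inc d) (clear d))
        (loop d.+2 (pseq (dec d.+2) left_in))))).
exists (fun B => b1 B * 20 + 20); split; first by polyb.
move=> rho d v o x B Hf HL HB; have [_ _ Hz] := Hf.
have [|le1 T1] := H1 rho d.+1 v o x B _ HL HB.
  by apply: fits_above Hf _ _ _ => // i ?; have := Hz i; lia.
split; first by case: nth; lia.
pose S k := Conf (upd (upd v d.+1 (F x - k)) d.+2 k) k o.
have T2 : triple (inp x) (Conf (upd v d.+1 (F x)) 0 o)
    (loop d.+1 (pseq (dec d.+1) (pseq (inc d.+2) right_in))) (F x * 9 + 1) (S (F x)).
  apply: triple_weaken (@triple_loop (inp x) d.+1 _ S (F x) 7 _ _ _)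
    _ _ _ _ _ _ _ => //=.
  - by move=> j lt_j; regs.
  - by regs.
  - move=> j lt_j; apply: triple_post (triple_seq (triple_dec _)
      (triple_seq (triple_inc _) (@triple_right _ _ _ _))) _ _ _ _ => //=.
      by regs.
    by cells.
  - by move=> q; have := Hz q; regs.
pose b := nth false (inp x) (F x).
have T3 : triple (inp x) (S (F x)) (pif 1 istrue (inc d) (clear d)) 5
    (Conf (upd (reg (S (F x))) d b) (F x) o).
  apply: hoare_if => T [HT]; rewrite (rep_istrue HT) /= -/b => Eb.
    have H : triple (inp x) (S (F x)) (inc d) 4 (Conf (upd (reg (S (F x))) d b) (F x) o).
      apply: triple_post (triple_inc _) _ _ _ _ => //=.
      by move=> q; have := Hz q; rewrite Eb; regs.
    by apply: H.
  have H : triple (inp x) (S (F x)) (clear d) 4 (Conf (upd (reg (S (F x))) d b) (F x) o).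
    apply: triple_post (triple_clear _) _ _ _ _ => //=.
      by move=> q; have := Hz q; rewrite (negbTE Eb); regs.
    by have := Hz d (leqnn d); regs.
  by apply: H.
pose S' k := Conf (upd (upd v d b) d.+2 (F x - k)) (F x - k) o.
have T4 : triple (inp x) (Conf (upd (reg (S (F x))) d b) (F x) o)
    (loop d.+2 (pseq (dec d.+2) left_in)) (F x * 5 + 1) (Conf (upd v d b) 0 o).
  apply: triple_weaken (@triple_loop (inp x) d.+2 _ S' (F x) 3 _ _ _)
    _ _ _ _ _ _ _ => //=.
  - by move=> j lt_j; regs.
  - by regs.
  - move=> j lt_j; rewrite /S'; have -> : F x - j = (F x - j.+1).+1 by lia.
    apply: triple_post (triple_seq (triple_dec _) (@triple_left _ _ _ _)) _ _ _ _ => //=.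
      by regs.
    by cells.
  - by lia.
  - by move=> q; have := Hz q; regs.
  - by lia.
  - by move=> q; have := Hz q; regs.
apply: triple_post (triple_seq T1 (triple_seq T2 (triple_seq T3 T4))) _ _ _ _ => //=.
by lia.
Qed.

(* Only decreasing functions are iterated, to keep the values polynomially bounded. *)
Lemma cfun_iter (F G : X -> nat) (H : X -> nat -> nat) :
    (forall x n, H x n <= n) -> cfun F -> cfun G -> cfun' H ->
  cfun (fun x => iter (F x) (H x) (G x)).
Proof.
move=> leH [M1 [b1 [pb1 H1]]] [M2 [b2 [pb2 H2]]] [M3 [b3 [pb3 H3]]].
have le_iter x n m : iter n (H x) m <= m.
  by elim: n => //= n IH; apply: leq_trans (leH _ _) IH.
exists (fun rho d => pseq (M2 rho d) (pseq (M1 rho d.+1) (loop d.+1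
  (pseq (M3 (d :: rho) d.+2) (pseq (clear d) (pseq (transfer d.+2 d) (dec d.+1))))))).
exists (fun B => b2 B + b1 B + b1 B * (b3 (B + b2 B) + b2 B * 10 + 20) + 10).
split; first by polyb.
move=> rho d v o x B Hf HL HB; have [_ _ Hz] := Hf.
have [le2 T2] := H2 rho d v o x B Hf HL HB.
have [|le1 T1] := H1 rho d.+1 (upd v d (G x)) o x B _ HL HB.
  by apply: fits_above Hf _ _ _ => // i ?; have := Hz i; regs.
split; first by have := le_iter x (F x) (G x); lia.
pose S k := Conf (upd (upd v d (iter k (H x) (G x))) d.+1 (F x - k)) 0 o.
have T3 : triple (inp x) (Conf (upd (upd v d (G x)) d.+1 (F x)) 0 o) (loop d.+1
    (pseq (M3 (d :: rho) d.+2) (pseq (clear d) (pseq (transfer d.+2 d) (dec d.+1)))))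
    (F x * (b3 (B + b2 B) + b2 B * 10 + 10) + 1)
    (Conf (upd v d (iter (F x) (H x) (G x))) 0 o).
  apply: triple_weaken (@triple_loop (inp x) d.+1 _ S (F x)
    (b3 (B + b2 B) + b2 B * 10 + 8) _ _ _) _ _ _ _ _ _ _ => //=.
  - by move=> j lt_j; regs.
  - by regs.
  - move=> j lt_j; set a := iter j (H x) (G x).
    have le_a : a <= G x := le_iter _ _ _.
    have le_Ha : H x a <= a := leH _ _.
    have [|||le3 T3] := H3 (d :: rho) d.+2 (reg (S j)) o (x, a) (B + b2 B).
    + have E : reg (S j) d = a by regs.
      rewrite vars'_vals -[X in fits _ _ _ (X :: _)]E.
      by apply: (fits_cons Hf) => [|i ?|i ?]; first lia; have := Hz i; regs.
    + by rewrite /=; lia.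
    + by apply: vars'_bound (bound_weaken _ HB) => /=; lia.
    apply: triple_post (triple_seq T3 (triple_seq (triple_clear _) (triple_seq
      (triple_transfer _) (triple_dec _)))) _ _ _ _ => //=.
    + by regs.
    + by regs.
    + by move=> q; have := Hz q; rewrite -/a; regs.
    + by rewrite -/a; regs.
  - by move=> q; have := Hz q; regs.
  - by move=> q; have := Hz q; regs.
  - by lia.
apply: triple_post (triple_seq T2 (triple_seq T1 T3)) _ _ _ _ => //=.
by nia.
Qed.

Lemma cfun_weak F : cfun F -> cfun' (fun x _ => F x).
Proof.
move=> [M [b [pb H]]]; exists (fun rho d => M (behead rho) d), b; split=> //.
move=> [|t rho] d v o [x i] B; rewrite vars'_vals => - [] //= [_ Hm] /andP[_ Ha] Hz.
move=> HL /andP[_]; rewrite all_map => HB; exact: H.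
Qed.

Lemma cgen_nil : cgen (fun=> [::]).
Proof.
exists (fun _ d => clear d), (fun=> 1); split; first by polyb.
move=> rho d v o x B [_ _ Hz] _ _; split=> //.
apply: triple_post (triple_clear _) _ _ _ _ => //=; rewrite ?cats0 ?Hz //.
by move=> q; have := Hz q; regs.
Qed.

Lemma cgen_bit b : cgen (fun=> [:: b]).
Proof.
exists (fun _ d => emit b), (fun=> 1); split; first by polyb.
move=> rho d v o x B _ _ _; split=> //; rewrite cats1; exact: triple_emit.
Qed.

Lemma cgen_cat F G : cgen F -> cgen G -> cgen (fun x => F x ++ G x).
Proof.
move=> [M1 [b1 [pb1 H1]]] [M2 [b2 [pb2 H2]]].
exists (fun rho d => pseq (M1 rho d) (M2 rho d)), (fun B => b1 B + b2 B + 1).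
split; first by polyb.
move=> rho d v o x B Hf HL HB.
have [le1 T1] := H1 rho d v o x B Hf HL HB.
have [le2 T2] := H2 rho d v (o ++ F x) x B Hf HL HB.
by rewrite size_cat; split; [lia | rewrite catA; apply: triple_seq T1 T2].
Qed.

Lemma cgen_if (P : X -> bool) F G :
    cfun (fun x => P x) -> cgen F -> cgen G -> cgen (fun x => if P x then F x else G x).
Proof.
move=> [M [b [pb H]]] [M1 [b1 [pb1 H1]]] [M2 [b2 [pb2 H2]]].
exists (fun rho d => pseq (M rho d) (ifnz d (pseq (clear d) (M1 rho d)) (M2 rho d))).
exists (fun B => b B + b1 B + b2 B + 10); split; first by polyb.
move=> rho d v o x B Hf HL HB; have [_ _ Hz] := Hf.
have [le T] := H rho d v o x B Hf HL HB.
have [le1 T1] := H1 rho d v o x B Hf HL HB.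
have [le2 T2] := H2 rho d v o x B Hf HL HB.
split; first by case: (P x); lia.
apply: triple_post (triple_seq T (@triple_ifnz _ _ _ _ _
  (Conf v 0 (o ++ (if P x then F x else G x))) (b1 B + b2 B + 5) _ _))
  _ _ _ _ => //=; rewrite ?updE.
- case: (P x) => // _; apply: triple_post (triple_seq (triple_clear _)
    (@triple_weaken _ _ _ _ _ _ _ (Conf v 0 (o ++ F x)) T1
      _ _ _ _ _ _ (leqnn _))) _ _ _ _ => //=.
    by move=> q; have := Hz q; regs.
  by regs.
- case: (P x) => // _; apply: triple_weaken T2 _ _ _ _ _ _ _ => //=.
    by move=> q; have := Hz q; regs.
  by lia.
by lia.
Qed.

(** The value stays on counter [d] as a further variable of [G] and is erased afterwards. In this
    way decoded numbers become variables for the later stages. *)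
Lemma cgen_let F (G : X -> nat -> seq bool) : cfun F -> cgen' G ->
  cgen (fun x => G x (F x)).
Proof.
move=> [M1 [b1 [pb1 H1]]] [M2 [b2 [pb2 H2]]].
exists (fun rho d => pseq (M1 rho d) (pseq (M2 (d :: rho) d.+1) (clear d))).
exists (fun B => b1 B * 4 + b2 (B + b1 B) + 10); split; first by polyb.
move=> rho d v o x B Hf HL HB; have [_ _ Hz] := Hf.
have [le1 T1] := H1 rho d v o x B Hf HL HB.
have [|||le2 T2] := H2 (d :: rho) d.+1 (upd v d (F x)) o (x, F x) (B + b1 B).
- have E : upd v d (F x) d = F x by regs.
  rewrite vars'_vals -[X in fits _ _ _ (X :: _)]E.
  by apply: (fits_cons Hf) => [|i ?|i ?]; first lia; have := Hz i; regs.
- by rewrite /=; lia.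
- by apply: vars'_bound (bound_weaken _ HB) => /=; lia.
split; first by rewrite /= in le2; lia.
apply: triple_post (triple_seq T1 (triple_seq T2 (triple_clear _))) _ _ _ _ => //=.
  by move=> q; have := Hz q; regs.
by regs.
Qed.

Lemma cgen_for F (G : X -> nat -> seq bool) : cfun F -> cgen' G ->
  cgen (fun x => flatten [seq G x i | i <- iota 0 (F x)]).
Proof.
move=> [M1 [b1 [pb1 H1]]] [M2 [b2 [pb2 H2]]].
exists (fun rho d => pseq (M1 rho d) (pseq (loop d
  (pseq (M2 (d.+1 :: rho) d.+2) (pseq (inc d.+1) (dec d)))) (clear d.+1))).
exists (fun B => b1 B * 4 + b1 B * (b2 (B + b1 B) + 10) + 10); split; first by polyb.
move=> rho d v o x B Hf HL HB; have [_ _ Hz] := Hf.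
have [le1 T1] := H1 rho d v o x B Hf HL HB.
pose out_ k := flatten [seq G x i | i <- iota 0 k].
have outS k : out_ k.+1 = out_ k ++ G x k.
  by rewrite /out_ -addn1 iotaD map_cat flatten_cat /= cats0.
pose S k := Conf (upd (upd v d (F x - k)) d.+1 k) 0 (o ++ out_ k).
have HG k : k < F x -> size (G x k) <= b2 (B + b1 B) /\
    triple (inp x) (S k) (M2 (d.+1 :: rho) d.+2) (b2 (B + b1 B))
      (Conf (reg (S k)) 0 (o ++ out_ k.+1)).
  move=> lt_k; rewrite outS catA.
  apply: H2 (d.+1 :: rho) d.+2 (reg (S k)) _ (x, k) (B + b1 B) _ _ _.
  - have E : reg (S k) d.+1 = k by regs.
    rewrite vars'_vals -[X in fits _ _ _ (X :: _)]E.
    by apply: (fits_cons Hf) => [|i ?|i ?]; first lia; have := Hz i; regs.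
  - by rewrite /=; lia.
  - by apply: vars'_bound (bound_weaken _ HB) => /=; lia.
have sz k : k <= F x -> size (out_ k) <= k * b2 (B + b1 B).
  elim: k => // k IH lt_k; rewrite outS size_cat mulSnr leq_add //.
    by apply: IH; lia.
  by have [] := HG k lt_k.
split; first by have := sz _ (leqnn _); rewrite -/(out_ _); nia.
have T2 : triple (inp x) (Conf (upd v d (F x)) 0 o) (loop d
  (pseq (M2 (d.+1 :: rho) d.+2) (pseq (inc d.+1) (dec d))))
    (F x * (b2 (B + b1 B) + 8) + 1) (S (F x)).
  apply: triple_weaken (@triple_loop (inp x) d _ S (F x)
    (b2 (B + b1 B) + 6) _ _ _) _ _ _ _ _ _ _ => //=.
  - by move=> j lt_j; regs.
  - by regs.
  - move=> j lt_j; have [_ T] := HG j lt_j.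
    apply: triple_post (triple_seq T (triple_seq (triple_inc _) (triple_dec _)))
      _ _ _ _ => //=.
    + by regs.
    + by cells.
    + by lia.
  - by rewrite cats0.
  - by move=> q; have := Hz q; regs.
  - by lia.
apply: triple_post (triple_seq T1 (triple_seq T2 (triple_clear _))) _ _ _ _ => //=.
  by move=> q; have := Hz q; regs.
by regs; nia.
Qed.

End Closure.

(** * Arithmetic, comparisons and binary digits *)

Section Arithmetic.

Variables (X : Type) (inp : X -> seq bool) (vars : seq (X -> nat)).
Local Notation cfun := (cfun inp vars).

Implicit Types (F G : X -> nat) (P Q : X -> bool).

Lemma cfun_mul F G : cfun F -> cfun G -> cfun (fun x => F x * G x).
Proof.
move=> HF /cfun_weak HG; apply: eq_cfun (@cfun_sum _ _ _ F (fun x _ => G x) HF HG) => x.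
by rewrite sum_nat_const card_ord.
Qed.

Lemma cfun_succ F : cfun F -> cfun (fun x => (F x).+1).
Proof.
move=> HF; apply: eq_cfun (cfun_add HF (cfun_const _ _ 1)) => x; exact: addn1.
Qed.

(** By truncation [1 - (F x - G x)] is the truth value of the comparison. *)
Lemma cfun_leq F G : cfun F -> cfun G -> cfun (fun x => F x <= G x).
Proof.
move=> HF HG; apply: eq_cfun (cfun_sub (cfun_const _ _ 1) (cfun_sub HF HG)) => x.
by lia.
Qed.

Lemma cfun_not P : cfun (fun x => P x) -> cfun (fun x => ~~ P x).
Proof.
move=> HP; apply: eq_cfun (cfun_sub (cfun_const _ _ 1) HP) => x.
by case: (P x).
Qed.

Lemma cfun_and P Q : cfun (fun x => P x) -> cfun (fun x => Q x) ->
  cfun (fun x => P x && Q x).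
Proof. by move=> HP HQ; apply: eq_cfun (cfun_mul HP HQ) => x; rewrite mulnb. Qed.

Lemma cfun_or P Q : cfun (fun x => P x) -> cfun (fun x => Q x) ->
  cfun (fun x => P x || Q x).
Proof.
move=> /cfun_not HP /cfun_not HQ; apply: eq_cfun (cfun_not (cfun_and HP HQ)) => x.
by rewrite negb_and !negbK.
Qed.

Lemma cfun_eq F G : cfun F -> cfun G -> cfun (fun x => F x == G x).
Proof.
move=> HF HG; apply: eq_cfun (cfun_and (cfun_leq HF HG) (cfun_leq HG HF)) => x.
by rewrite -eqn_leq.
Qed.

End Arithmetic.

(** Allows a number to be computed by counting the [t] that pass a test equivalent to [t < q]. *)
Lemma sum_ltn a q : q <= a -> \sum_(t < a) (t < q : nat) = q.
Proof.
elim: a q => [|a IH] [|q] //= le_q; first by rewrite big_ord0.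
  by rewrite big1.
by rewrite big_ord_recl /= IH.
Qed.

Section Division.

Variables (X : Type) (inp : X -> seq bool) (vars : seq (X -> nat)).
Local Notation cfun := (cfun inp vars).

(** The quotient is the number of positive multiples of the divisor up to [F x]. The divisor is a
    successor, hence not zero. *)
Lemma cfun_div (F G : X -> nat) : cfun F -> cfun G -> cfun (fun x => F x %/ (G x).+1).
Proof.
move=> HF HG.
have H := cfun_leq (cfun_mul (cfun_succ (@cfun_var (X * nat) (fun p => inp p.1)
  (vars' vars) 0 isT)) (cfun_succ (cfun_weak HG))) (cfun_weak HF).
apply: eq_cfun (@cfun_sum _ _ _ F (fun x i => i.+1 * (G x).+1 <= F x : nat) HF H) => x.
rewrite -[RHS](@sum_ltn (F x)) ?leq_div //.
by apply: eq_bigr => i _; rewrite leq_divRL.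
Qed.

Lemma cfun_mod (F G : X -> nat) : cfun F -> cfun G -> cfun (fun x => F x %% (G x).+1).
Proof.
move=> HF HG; apply: eq_cfun (cfun_sub HF (cfun_mul (cfun_div HF HG) (cfun_succ HG))).
by move=> x; rewrite {1}(divn_eq (F x) (G x).+1) addKn.
Qed.

Lemma cfun_odd (F : X -> nat) : cfun F -> cfun (fun x => odd (F x)).
Proof.
by move=> HF; apply: eq_cfun (cfun_mod HF (cfun_const _ _ 1)) => x; rewrite modn2.
Qed.

End Division.

(** Halving never increases a number, so it may be iterated. *)
Lemma cfun_bit X (inp : X -> seq bool) vars F G : cfun inp vars F -> cfun inp vars G ->
  cfun inp vars (fun x => odd (iter (F x) half (G x))).
Proof.
move=> HF HG; apply: cfun_odd.
have H := cfun_div (@cfun_var (X * nat) (fun p => inp p.1) (vars' vars) 0 isT)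
  (cfun_const _ _ 1).
apply: (@cfun_iter _ _ _ F G (fun _ n => n./2) _ HF HG); first by move=> _ n; lia.
by apply: eq_cfun H => p; rewrite divn2.
Qed.

(** * Preparation of the counters and delivery of the output *)

Definition lead (z : seq bool) : nat := find negb z.

Lemma lead_true z i : i < lead z -> nth false z i.
Proof. by move=> /(before_find false)/negbFE. Qed.

Lemma lead_false z : nth false z (lead z) = false.
Proof.
rewrite /lead; have [lt|ge] := ltnP (find negb z) (size z).
  by move: lt; rewrite -has_find => /(nth_find false)/negbTE.
by rewrite nth_default.
Qed.

(* [lead z] is the parameter [k] when [z = pair_code x k], so that on top of the
   length of the input the machines have [2 ^ k] at their disposal. *)
Definition vars0 : seq (seq bool -> nat) := [:: size; fun z => 2 ^ lead z].

(** Counter 1 starts at 1 and is doubled for each leading [true] by adding a copy of it to itself.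
    Counter 0 counts all symbols, and a copy of it then guides the head back to the start. *)
Definition scan :=
  pseq (incs 1 1) (pseq
    (pwhile 1 istrue (pseq right_in (pseq (inc 0) (pseq (copy 1 2 3) (transfer 2 1)))))
    (pseq (pwhile 1 isSome (pseq right_in (inc 0)))
    (pseq (copy 0 2 3) (loop 2 (pseq (dec 2) left_in))))).

Lemma triple_scan z :
  triple z (Conf (fun=> 0) 0 [::]) scan ((size z + 2 ^ lead z + 10) ^ 3)
    (Conf (upd (upd (fun=> 0) 0 (size z)) 1 (2 ^ lead z)) 0 [::]).
Proof.
have le_lead : lead z <= size z := find_size _ _.
pose v L E := upd (upd (fun=> 0) 0 L) 1 E.
pose S1 j := Conf (v j (2 ^ j)) j [::].
have T1 : triple z (S1 0)
    (pwhile 1 istrue (pseq right_in (pseq (inc 0) (pseq (copy 1 2 3) (transfer 2 1)))))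
    (lead z * (2 ^ lead z * 25 + 20) + 1) (S1 (lead z)).
  apply: hoare_weaken (@hoare_while (fun j => rep z (S1 j)) (lead z) 1 istrue _
    (2 ^ lead z * 25 + 12) _ _ _) => //.
  - by lia.
  - by move=> j T lt_j /rep_istrue->; apply: lead_true.
  - by move=> T /rep_istrue->; rewrite lead_false.
  move=> j lt_j.
  have le_pow : 2 ^ j <= 2 ^ lead z by rewrite leq_exp2l // ltnW.
  have H : triple z (S1 j)
      (pseq right_in (pseq (inc 0) (pseq (copy 1 2 3) (transfer 2 1))))
      (2 ^ lead z * 25 + 12) (S1 j.+1).
    apply: triple_post (triple_seq (@triple_right _ _ _ _) (triple_seq (triple_inc _)
      (triple_seq (triple_copy _ _ _ _ _) (triple_transfer _)))) _ _ _ _ => //=.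
    + by rewrite /v expnS; cells.
    + by rewrite /v /upd /=; lia.
  exact: H.
pose S2 j := Conf (v (lead z + j) (2 ^ lead z)) (lead z + j) [::].
have T2 : triple z (S1 (lead z)) (pwhile 1 isSome (pseq right_in (inc 0)))
    (size z * 9 + 1) (Conf (v (size z) (2 ^ lead z)) (size z) [::]).
  apply: hoare_weaken (@hoare_while (fun j => rep z (S2 j)) (size z - lead z) 1 isSome _
    5 _ _ _) => //.
  - by rewrite /S2 addn0.
  - by rewrite /S2 subnKC.
  - by lia.
  - by move=> j T lt_j /rep_nonblank-> /=; lia.
  - by move=> T /rep_nonblank-> /=; lia.
  move=> j lt_j.
  have H : triple z (S2 j) (pseq right_in (inc 0)) 5 (S2 j.+1).
    rewrite /S2 addnS.
    apply: triple_post (triple_seq (@triple_right _ _ _ _) (triple_inc _)) _ _ _ _ => //=.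
    by rewrite /v; cells.
  exact: H.
pose S3 j := Conf (upd (v (size z) (2 ^ lead z)) 2 (size z - j)) (size z - j) [::].
have T3 : triple z (S3 0) (loop 2 (pseq (dec 2) left_in))
    (size z * 5 + 1) (Conf (v (size z) (2 ^ lead z)) 0 [::]).
  apply: triple_weaken (@triple_loop z 2 _ S3 (size z) 3 _ _ _) _ _ _ _ _ _ _ => //=.
  - by move=> j lt_j; rewrite /v; regs.
  - by rewrite /v; regs.
  - move=> j lt_j; rewrite /S3; have -> : size z - j = (size z - j.+1).+1 by lia.
    apply: triple_post (triple_seq (triple_dec _) (@triple_left _ _ _ _)) _ _ _ _ => //=.
    by cells.
  - by lia.
  - by rewrite /v; cells.
have T0 : triple z (Conf (fun=> 0) 0 [::]) (incs 1 1) 5 (S1 0).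
  by apply: triple_post (triple_incs 1 _) _ _ _ _ => //=; rewrite /v; cells.
apply: triple_post (triple_seq T0 (triple_seq T1 (triple_seq T2
  (triple_seq (triple_copy _ _ _ _ _) (@triple_weaken _ _ _ _ _ _ _
   (Conf (v (size z) (2 ^ lead z)) 0 [::]) T3 _ _ _ _ _ _ (leqnn _))))))
  _ _ _ _ => //=.
- by lia.
- by rewrite subn0 /v; cells.
rewrite {1}/v /upd /= !expnS expn0.
have : 0 < 2 ^ lead z by rewrite expn_gt0.
by nia.
Qed.

(** The output is read from the head on, but after writing the head stands behind it. *)
Definition rewind :=
  pseq (atom 0 id Left) (pseq (pwhile 0 isSome (atom 0 id Left)) (atom 0 id Right)).

Lemma hoare_rewind o :
  hoare (fun T => T 0 = Tape (rev (bits_cells o)) None [::]) rewind (size o * 3 + 10)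
    (fun T => read_bits (cur (T 0) :: right (T 0)) = o).
Proof.
set s := bits_cells o; have sz : size s = size o by rewrite size_map.
(* After [j] rounds the head scans symbol [j] from the end, or the blank before the output once [j]
   is its length. *)
pose I j (T : nat -> tape void) :=
  [/\ left (T 0) = drop j.+1 (rev s), cur (T 0) = nth None (rev s) j &
      right (T 0) = rev (take j (rev s)) ++ [:: None]].
have HI : hoare (I 0) (pwhile 0 isSome (atom 0 id Left)) (size s * (1 + 2) + 1) (I (size s)).
  apply: hoare_while => [j T lt_j [_ -> _]|T [_ -> _]|j lt_j].
  - rewrite nth_rev // (nth_map false) //; by rewrite sz in lt_j *; lia.
  - by rewrite nth_default // size_rev.
  apply: hoare_atom => T [El Ec Er]; rewrite /I updE /= El Ec Er; split.
  - by rewrite -drop1 drop_drop.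
  - by rewrite -nth0 nth_drop addn0.
  by rewrite (take_nth None) ?size_rev // rev_rcons.
apply: hoare_weaken (hoare_seq (_ : hoare _ _ 1 (I 0)) (hoare_seq HI
  (_ : hoare _ _ 1 (fun T => cur (T 0) :: right (T 0) = s ++ [:: None])))).
- by move=> T; apply.
- move=> T ->; rewrite /s; elim: {I HI s sz} o => //= b o IH; by rewrite IH.
- by lia.
- apply: hoare_atom => T E; rewrite /I updE /= E /=; split=> //.
    by rewrite drop1.
  by case: (rev s).
apply: hoare_atom => T [El Ec Er]; rewrite updE /= Er.
rewrite take_oversize ?size_rev // revK.
by case: (s).
Qed.

Lemma rep_init z : rep z (Conf (fun=> 0) 0 [::]) (init_store z).
Proof.
split=> //=; last by move=> i; exists [::].
split=> // i; rewrite add0n /init_store /= /input_tape.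
by case: z => [|b z] //=; case: i => [|[|i]].
Qed.

(** [B = size z + 2 ^ lead z] dominates the input length and both variables, which [scan] puts on
    counters 0 and 1. *)
Lemma cgen_run (G : seq bool -> seq bool) : cgen id vars0 G ->
  exists (P : prog) D, forall z t, (size z + 2 ^ lead z + 2) ^ D <= t ->
    outputs_within (tm P) z t (G z).
Proof.
move=> [M [b [pb H]]].
pose t B := (B + 10) ^ 3 + b B + (b B * 3 + 10) + 2.
have [_ [D HD]] : polyb t.
  have pc : polyb (fun B => (B + 10) ^ 3).
    by rewrite /expn /=; polyb.
  by rewrite /t; polyb.
exists (pseq scan (pseq (M [:: 0; 1] 2) rewind)), D => z t' ge_t'.
have le_t := HD (size z + 2 ^ lead z).
pose v := upd (upd (fun=> 0) 0 (size z)) 1 (2 ^ lead z).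
have [||| le_b TM] := H [:: 0; 1] 2 v [::] z (size z + 2 ^ lead z).
- by split=> // -[|[|i]].
- exact: leq_addr.
- by rewrite /= leq_addr leq_addl.
have TR : hoare (rep z (Conf v 0 ([::] ++ G z))) rewind (size (G z) * 3 + 10)
    (fun T => read_bits (cur (T 0) :: right (T 0)) = G z).
  by apply: hoare_weaken (@hoare_rewind (G z)) => // T [].
have [T' [t1 [X le_t1 <-]]] := hoare_seq (@triple_scan z) (hoare_seq TM TR) (rep_init z).
apply: exec_outputs_within X _.
apply: leq_trans ge_t'; apply: leq_trans le_t; apply: leq_trans le_t1 _.
by rewrite /t; lia.
Qed.

Lemma lead_unary k s : lead (unary k ++ s) = k.
Proof. by rewrite /lead /unary cat_rcons; elim: k => //= k ->. Qed.


(** A number in unary is the output of a loop that emits one [true] per round. *)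
Lemma cfun_computable f (F : seq bool -> nat) : cfun id vars0 F ->
  (forall k, F (nseq k true) = f k) -> computable f.
Proof.
move=> HF Ef.
have [P [D H]] := cgen_run (cgen_for (G := fun _ _ => [:: true]) HF (cgen_bit _ _ true)).
exists (tm P) => k; eexists; move: (H (nseq k true) _ (leqnn _)); rewrite Ef.
suff -> : flatten [seq [:: true] | _ <- iota 0 (f k)] = nseq (f k) true by apply.
by elim: (f k) 0 => //= n IH m; rewrite IH.
Qed.

(** The factor depending on the parameter is computable because it is built from the variables,
    which on [nseq k true] are [k] and [2 ^ k]. *)
Lemma cgen_fpt_reducible (P P' : pproblem) (G : seq bool -> seq bool) g :
    cgen id vars0 G -> computable g ->
    (forall x k, exists x' k',
      [/\ G (pair_code x k) = pair_code x' k', k' <= g k & P x k <-> P' x' k']) ->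
  fpt_reducible P P'.
Proof.
move=> HG Hg HP; have [A [D HA]] := cgen_run HG.
(* With [size z = k + 1 + size x], the sum [size z + 2 ^ k + 2] is at most the product of
   [k + 2 ^ k + 3] and [size x + 1], and the power of a product splits. *)
exists (tm A), (fun k => (k + 2 ^ k + 3) ^ D), g, D; split=> //.
  apply: (@cfun_computable _ (fun z => (size z + 2 ^ lead z + 3) ^ D)).
    elim: D {HA} => [|D IH]; first exact: cfun_const.
    apply: (@eq_cfun _ _ _ _ _ _ (cfun_mul (cfun_add (cfun_add
      (@cfun_var _ id vars0 0 isT) (@cfun_var _ id vars0 1 isT))
      (cfun_const _ _ 3)) IH)) => z; by rewrite expnS.
  have lead_nseq k : lead (nseq k true) = k by rewrite /lead; elim: k => //= k ->.
  by move=> k; rewrite size_nseq lead_nseq.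
move=> x k; have [x' [k' [E le_k HPP]]] := HP x k.
exists x', k'; split=> //; rewrite -E; apply: HA.
rewrite /pair_code lead_unary size_cat size_rcons size_nseq -expnMn.
by case: (D) => // d; rewrite leq_exp2r //; nia.
Qed.

(** * Monotone CNFs as circuits of weft 2 *)

Definition clause N (phi : pred nat) : seq nat := filter phi (iota 0 N).

(** Clause [i] is the gate on wire [N + i], so the output gate is the conjunction of all clauses. *)
Definition cnf N (cs : seq (pred nat)) : circuit :=
  Circuit N (rcons [seq Or (clause N phi) | phi <- cs] (And (iota N (size cs)))).

Lemma all_fanin_or N cs :
  all (fun g => all (fun j => j < N) (fanin g)) [seq Or (clause N phi) | phi <- cs].
Proof.
rewrite all_map; elim: cs => //= phi cs ->; rewrite andbT.
by apply/allP => j; rewrite mem_filter mem_iota => /andP[].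
Qed.

(** All gates but the last read inputs only, so their labels do not depend on each other. Stated for
    any [h] that only looks at the fan-in, this serves value, depth and weft alike. *)
Lemma sweep_rcons T (x0 : T) (h : gate -> (nat -> T) -> T) w gs g :
    (forall g v v', {in fanin g, v =1 v'} -> h g v = h g v') ->
    all (fun g => all (fun j => j < size w) (fanin g)) gs ->
  sweep x0 h w (rcons gs g) =
  h g (nth x0 (w ++ [seq h g (nth x0 w) | g <- gs])).
Proof.
move=> Hh Hgs; rewrite /sweep foldl_rcons last_rcons; congr (h g (nth x0 _)).
elim/last_ind: gs Hgs => [|gs g' IH]; first by rewrite cats0.
rewrite all_rcons => /andP[/allP Hg' /IH E].
rewrite foldl_rcons E map_rcons rcons_cat; congr (_ ++ rcons _ _).
by apply: Hh => j /Hg'; rewrite nth_cat => ->.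
Qed.

Lemma eq_bigmax_in (s : seq nat) (v v' : nat -> nat) : {in s, v =1 v'} ->
  \max_(j <- s) v j = \max_(j <- s) v' j.
Proof. by move=> E; apply: eq_big_seq => j /E. Qed.

Lemma weft_cnf N cs : weft (cnf N cs) <= 2.
Proof.
rewrite /weft sweep_rcons ?size_nseq ?all_fanin_or //=; last first.
  by move=> g v v' /eq_bigmax_in->.
rewrite -[2]/(1 + 1); apply: leq_add; first exact: leq_b1.
apply/bigmax_leqP_seq => j; rewrite mem_iota => Hj _.
rewrite nth_cat size_nseq; case: ltnP => [lt_j|ge_j]; first by rewrite nth_nseq lt_j.
rewrite -map_comp (nth_map xpred0) /=; last by rewrite ltn_subLR //; case/andP: Hj.
rewrite -[1]/(1 + 0); apply: leq_add; first exact: leq_b1.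
by apply/bigmax_leqP_seq => i _ _; rewrite nth_nseq if_same.
Qed.

Lemma depth_cnf N cs : depth (cnf N cs) <= 2.
Proof.
rewrite /depth sweep_rcons ?size_nseq ?all_fanin_or //=; last first.
  by move=> g v v' /eq_bigmax_in->.
rewrite ltnS; apply/bigmax_leqP_seq => j; rewrite mem_iota => Hj _.
rewrite nth_cat size_nseq; case: ltnP => [lt_j|ge_j]; first by rewrite nth_nseq lt_j.
rewrite -map_comp (nth_map xpred0) /=; last by rewrite ltn_subLR //; case/andP: Hj.
by rewrite ltnS; apply/bigmax_leqP_seq => i _ _; rewrite nth_nseq if_same.
Qed.

Lemma wf_cnf N cs : wf_circuit (cnf N cs).
Proof.
split=> /=; first by rewrite size_rcons addnS.
move=> i; rewrite size_rcons ltnS leq_eqVlt size_map => /predU1P[->|lt_i].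
  rewrite nth_rcons size_map ltnn eqxx /=.
  by apply/allP => j; rewrite mem_iota => /andP[].
rewrite nth_rcons size_map lt_i (nth_map xpred0) //=.
by apply/allP => j; rewrite mem_filter mem_iota => /andP[_]; lia.
Qed.

Lemma cnf_value N cs (a : N.-tuple bool) :
  @circuit_value (cnf N cs) a =
  all (fun phi => has (fun w => phi w && nth false a w) (iota 0 N)) cs.
Proof.
rewrite /circuit_value sweep_rcons ?size_tuple ?all_fanin_or //=; last first.
  case=> [j|l|l] v v' E /=; first by rewrite E ?mem_head.
    by apply: eq_in_all.
  by apply: eq_in_has.
rewrite -map_comp; set t := map _ cs.
have -> : all (nth false (a ++ t)) (iota N (size cs)) = all id t.
  rewrite -[t in RHS](drop_size_cat t (size_tuple a)).
  rewrite -[size cs](size_map ((gate_value^~ (nth false a)) \o (Or \o clause N))) -/t.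
  rewrite drop_size_cat ?size_tuple //.
  apply/(all_nthP 0)/(all_nthP false) => H i lt_i.
    have := H i; rewrite size_iota nth_iota // => /(_ lt_i).
    by rewrite nth_cat size_tuple ltnNge leq_addr addKn.
  rewrite size_iota in lt_i; rewrite nth_iota // nth_cat size_tuple.
  by rewrite ltnNge leq_addr addKn; apply: H.
rewrite /t all_map; apply: eq_all => phi /=.
by rewrite has_filter -filter_predI -has_filter; apply: eq_has => w /=; rewrite andbC.
Qed.

(** As [circuit_code] is injective, the instance determines the circuit. *)
Lemma cnf_sat N cs k :
  weighted_circuit_sat 2 2 (circuit_code (cnf N cs)) k <->
  exists2 a : N.-tuple bool, count id a = k &
    all (fun phi => has (fun w => phi w && nth false a w) (iota 0 N)) cs.
Proof.
split=> [[C [/circuit_code_inj EC _ _ _ [a ca]]]|[a ca Ha]].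
  by case: C / EC a ca => a ca; rewrite cnf_value; exists a.
exists (cnf N cs); split=> //; [exact: wf_cnf|exact: weft_cnf|exact: depth_cnf|].
by exists a => //; rewrite cnf_value.
Qed.

(** * Assignments with one true wire in each block *)

Section OneHot.

Variables (K p : nat).

(** Says that the true wires are the [i * p + pick i], in the form in which clauses are
    evaluated. *)
Definition hits (pick : nat -> nat) (a : seq bool) := forall phi : pred nat,
  has (fun w => phi w && nth false a w) (iota 0 (K * p)) =
  has (fun i => phi (i * p + pick i)) (iota 0 K).

Lemma block_lt i j : i < K -> j < p -> i * p + j < K * p.
Proof. by nia. Qed.

Lemma one_hot_ex (pick : nat -> nat) : (forall i, i < K -> pick i < p) ->
  exists2 a : (K * p).-tuple bool, count id a = K & hits pick a.
Proof.
move=> Hp; pose f w := w %% p == pick (w %/ p).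
have sz : size (mkseq f (K * p)) == K * p by rewrite size_mkseq.
have E : filter f (iota 0 (K * p)) =i [seq i * p + pick i | i <- iota 0 K].
  move=> w; rewrite mem_filter mem_iota /=; apply/andP/mapP.
    move=> [/eqP Hf lt_w]; exists (w %/ p).
      rewrite mem_iota /= ltn_divLR //.
      by case: p lt_w => //; rewrite muln0.
    by rewrite -Hf -divn_eq.
  move=> [i]; rewrite mem_iota /= => lt_i ->; have lt_p := Hp _ lt_i.
  rewrite /f divnMDl ?divn_small ?addn0 ?modnMDl ?modn_small ?eqxx; try by lia.
  by split=> //; apply: block_lt.
have Un : uniq [seq i * p + pick i | i <- iota 0 K].
  rewrite map_inj_in_uniq ?iota_uniq // => i i'; rewrite !mem_iota /= => Hi Hi'.
  move/(congr1 (divn^~ p)); rewrite !divnMDl; try by have := Hp _ Hi; lia.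
  by rewrite !divn_small ?addn0 ?Hp.
exists (Tuple sz) => [|phi] /=.
  rewrite /mkseq count_map -size_filter.
  rewrite -[RHS](size_iota 0) -[RHS](size_map (fun i => i * p + pick i)).
  by apply: perm_size; apply: uniq_perm => //; rewrite filter_uniq ?iota_uniq.
have -> : has (fun w => phi w && nth false (mkseq f (K * p)) w) (iota 0 (K * p)) =
    has phi (filter f (iota 0 (K * p))).
  rewrite [RHS]has_filter -filter_predI -has_filter; apply: eq_in_has => w.
  by rewrite mem_iota /= => lt_w; rewrite nth_mkseq.
by rewrite (eq_has_r E) has_map.
Qed.

(** Each of the [K] blocks has a true wire and only [K] wires are true, so the picked wires, a
    duplicate-free list of length [K] among them, are all of them. *)
Lemma one_hot_pick (a : (K * p).-tuple bool) : count id a = K ->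
    (forall i, i < K -> has (fun w => (w %/ p == i) && nth false a w) (iota 0 (K * p))) ->
  exists2 pick : nat -> nat, (forall i, i < K -> pick i < p) & hits pick a.
Proof.
move=> ca Ha; pose pick i := find (fun j => nth false a (i * p + j)) (iota 0 p).
have Hhas i : i < K -> has (fun j => nth false a (i * p + j)) (iota 0 p).
  move=> /Ha/hasP[w]; rewrite mem_iota /= => lt_w /andP[/eqP Ew Hw].
  have p0 : 0 < p by case: p lt_w => //; rewrite muln0.
  apply/hasP; exists (w %% p); first by rewrite mem_iota /= ltn_mod.
  by rewrite -Ew -divn_eq.
have Hp i : i < K -> pick i < p.
  by move/Hhas; rewrite has_find size_iota.
exists pick => // phi.
have Hpick i : i < K -> nth false a (i * p + pick i).
  by move=> lt_i; have := nth_find 0 (Hhas _ lt_i); rewrite nth_iota ?Hp.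
pose s := filter (nth false a) (iota 0 (K * p)).
have E : s =i [seq i * p + pick i | i <- iota 0 K].
  have Un : uniq [seq i * p + pick i | i <- iota 0 K].
    rewrite map_inj_in_uniq ?iota_uniq // => i i'; rewrite !mem_iota /= => Hi Hi'.
    move/(congr1 (divn^~ p)); rewrite !divnMDl; try by have := Hp _ Hi; lia.
    by rewrite !divn_small ?addn0 ?Hp.
  have sub : {subset [seq i * p + pick i | i <- iota 0 K] <= s}.
    move=> w /mapP[i]; rewrite mem_iota /= => lt_i ->.
    by rewrite mem_filter mem_iota /= Hpick ?block_lt ?Hp.
  have sz : size s <= size [seq i * p + pick i | i <- iota 0 K].
    rewrite size_map size_iota size_filter -[X in _ <= X]ca.
    rewrite -[X in count id X](mkseq_nth false) size_tuple /mkseq count_map.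
    by apply: sub_count.
  by have [_ Es] := uniq_min_size Un sub sz; move=> w; rewrite Es.
rewrite -[RHS](has_map (fun i => i * p + pick i)) -(eq_has_r E) /s.
rewrite [RHS]has_filter -filter_predI -has_filter; exact: eq_has.
Qed.

(** The hypothesis says that every block contains all wires of some clause. It quantifies over
    properties [Q] of all clauses because predicates have no decidable equality, hence no membership
    test. *)
Lemma cnf_sat_pick (cs : seq (pred nat)) :
    (forall Q : pred (pred nat), all Q cs ->
       forall i, i < K -> exists2 phi : pred nat, Q phi & forall w, phi w -> w %/ p = i) ->
  (weighted_circuit_sat 2 2 (circuit_code (cnf (K * p) cs)) K <->
   exists2 pick : nat -> nat, forall i, i < K -> pick i < p &
     all (fun phi : pred nat => has (fun i => phi (i * p + pick i)) (iota 0 K)) cs).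
Proof.
move=> Hcs; apply: (iff_trans (cnf_sat _ _ _)); split=> [[a ca Ha]|[pick Hp H]].
  have [|pick Hp Hh] := one_hot_pick ca.
    move=> i lt_i; have [phi /hasP[w Hw /andP[phiw aw]] Hphi] := Hcs _ Ha i lt_i.
    by apply/hasP; exists w => //; rewrite (Hphi w) // eqxx.
  by exists pick => //; rewrite (eq_all (fun phi => Hh phi)) in Ha.
have [a ca Hh] := one_hot_ex Hp; exists a => //.
by rewrite (eq_all (fun phi => Hh phi)).
Qed.

End OneHot.

(** * The clauses *)

Definition bit s i : bool := odd (iter i half s).

Definition parity k s : bool := odd (\sum_(0 <= i < k) bit s i).

Lemma bits_ex k (f : nat -> bool) : exists2 s, s < 2 ^ k & forall i, i < k -> bit s i = f i.
Proof.
elim: k f => [|k IH] f; first by exists 0.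
have [s lt_s Hs] := IH (fun i => f i.+1).
exists (f 0 + s.*2) => [|[|i] lt_i].
- by rewrite expnS; case: (f 0); lia.
- by rewrite /bit /= oddD odd_double addbF oddb.
by rewrite /bit iterSr half_bit_double -/(bit s i) Hs.
Qed.

(** The canonical CNF of a parity constraint: each pattern of the wrong parity is excluded by a
    clause, and those of the right parity give no condition. *)
Lemma parity_pattern k (f : nat -> bool) b :
  (forall s, s < 2 ^ k ->
     (parity k s == b) || has (fun i => f i != bit s i) (iota 0 k)) <->
  odd (\sum_(0 <= i < k) f i) = b.
Proof.
split=> [H|<- s _].
  (* The values of [f] form a pattern [s] themselves, from which [f] does not differ, so the parity
     of [s] has to be [b]. *)
  have [s lt_s Es] := bits_ex k f.
  have -> : odd (\sum_(0 <= i < k) f i) = parity k s.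
    by rewrite /parity; congr odd; apply: eq_big_nat => i /Es->.
  case/orP: (H s lt_s) => [/eqP//|/hasP[i]].
  by rewrite mem_iota => /Es->; rewrite eqxx.
case: hasP => [_|H]; rewrite ?orbT // orbF; apply/eqP; rewrite /parity; congr odd.
apply: eq_big_nat => i lt_i; congr nat_of_bool; apply/esym/eqP/negP => /negP ne.
by case: H; exists i => //; rewrite mem_iota.
Qed.

Section Clauses.

(* Wire [i * n.+1 + j] says that block [i] picks column [j], where [j = n] is no
   column. There are [k] blocks for the complement of the set of columns and one
   last block: if [exact] it picks no column, otherwise it picks a column outside
   the complement. *)
Variables (exact : bool) (k n : nat) (h : nat -> nat -> bool).

(** If [exact], the first [k] blocks have to pick columns because the complement has exactly [k]
    elements; otherwise they may pick none. *)
Definition allowed i j : bool :=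
  ((k <= i) || (~~ exact || (j < n))) &&
  ((i < k) || ((exact && (n <= j)) || (~~ exact && (j < n)))).

Definition block_clause i w : bool := (w %/ n.+1 == i) && allowed i (w %% n.+1).

(** For a complement of exactly [k] columns all picks must differ. Otherwise repetitions are
    harmless, and only the last block must differ from the others. *)
Definition conflict i i' : bool := (i < i') && (exact || (i' == k)).

(** Without a conflict the clause contains all wires. Such trivial clauses let the indices range
    freely, so that the number of clauses is a simple formula. *)
Definition distinct_clause i i' j w : bool :=
  ~~ conflict i i' ||
  (((w %/ n.+1 == i) || (w %/ n.+1 == i')) && (w %% n.+1 != j)).

Definition row_parity r : bool := odd (\sum_(0 <= j < n) h r j).

(** A pattern of the right parity gives a trivial clause. Picking no column counts as the value
    [false]. *)
Definition parity_clause r s w : bool :=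
  (parity k s == row_parity r) ||
  ((w %/ n.+1 < k) &&
   (((w %% n.+1 < n) && h r (w %% n.+1)) != bit s (w %/ n.+1))).

Definition clauses m : seq (pred nat) :=
  [seq block_clause i | i <- iota 0 k.+1] ++
  flatten [seq flatten [seq [seq distinct_clause i i' j | j <- iota 0 n]
    | i' <- iota 0 k.+1] | i <- iota 0 k.+1] ++
  flatten [seq [seq parity_clause r s | s <- iota 0 (2 ^ k)] | r <- iota 0 m].

Definition picks_ok m (pick : nat -> nat) : Prop :=
  [/\ forall i, i < k.+1 -> allowed i (pick i),
      forall i i' j, i < k.+1 -> i' < k.+1 -> j < n -> conflict i i' ->
        (pick i != j) || (pick i' != j) &
      forall r, r < m -> odd (\sum_(0 <= i < k) ((pick i < n) && h r (pick i))) =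
        row_parity r].

Lemma all_map_iotaP T (Q : pred T) F N :
  reflect (forall i, i < N -> Q (F i)) (all Q [seq F i | i <- iota 0 N]).
Proof.
by rewrite all_map; apply: (iffP allP) => H i; move: (H i); rewrite mem_iota.
Qed.

Lemma all_flatten_iotaP T (Q : pred T) F N :
  reflect (forall i, i < N -> all Q (F i)) (all Q (flatten [seq F i | i <- iota 0 N])).
Proof.
have -> (ss : seq (seq T)) : all Q (flatten ss) = all (all Q) ss.
  by elim: ss => //= s ss IH; rewrite all_cat IH.
exact: all_map_iotaP.
Qed.

Lemma clauses_pick m (pick : nat -> nat) : (forall i, i < k.+1 -> pick i < n.+1) ->
  all (fun phi : pred nat => has (fun i => phi (i * n.+1 + pick i)) (iota 0 k.+1))
    (clauses m) <->
  picks_ok m pick.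
Proof.
move=> Hp.
have hasE (phi : pred nat) : has (fun i => phi (i * n.+1 + pick i)) (iota 0 k.+1) <->
    exists2 i, i < k.+1 & phi (i * n.+1 + pick i).
  split=> [/hasP[i]|[i lt_i Hi]]; first by rewrite mem_iota => ? ?; exists i.
  by apply/hasP; exists i => //; rewrite mem_iota.
have dE i : i < k.+1 -> (i * n.+1 + pick i) %/ n.+1 = i.
  by move=> /Hp lt_p; rewrite divnMDl // divn_small // addn0.
have mE i : i < k.+1 -> (i * n.+1 + pick i) %% n.+1 = pick i.
  by move=> /Hp lt_p; rewrite modnMDl modn_small.
rewrite /clauses 2!all_cat.
split=> [/and3P[/all_map_iotaP H1 /all_flatten_iotaP H2 /all_flatten_iotaP H3]|[H1 H2 H3]].
  split.
  - move=> i lt_i; have /hasE[i' lt_i'] := H1 i lt_i.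
    by rewrite /block_clause dE ?mE // => /andP[/eqP<-].
  - move=> i i' j lt_i lt_i' lt_j Hc.
    have H2i := elimT (all_flatten_iotaP _ _ _) (H2 i lt_i) _ lt_i'.
    have /hasE[u lt_u] := elimT (all_map_iotaP _ _ _) H2i _ lt_j.
    rewrite /distinct_clause Hc /= dE ?mE // => /andP[/orP[]/eqP<- ->] //.
    by rewrite orbT.
  move=> r lt_r; apply/parity_pattern => s lt_s.
  have /hasE[u lt_u] := elimT (all_map_iotaP _ _ _) (H3 r lt_r) _ lt_s.
  rewrite /parity_clause dE ?mE // => /orP[->//|/andP[lt_u' Hu]].
  by apply/orP; right; apply/hasP; exists u => //; rewrite mem_iota.
apply/and3P; split.
- apply/all_map_iotaP => i lt_i; apply/hasE; exists i => //.
  by rewrite /block_clause dE ?mE // eqxx; apply: H1.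
- apply/all_flatten_iotaP => i lt_i; apply/all_flatten_iotaP => i' lt_i'.
  apply/all_map_iotaP => j lt_j; apply/hasE.
  (* A trivial clause contains every wire, so block 0 satisfies it. *)
  rewrite /distinct_clause; case Hc: (conflict i i') => /=; last by exists 0.
  have /orP[H|H] := H2 i i' j lt_i lt_i' lt_j Hc.
    by exists i => //; rewrite dE ?mE // eqxx.
  by exists i' => //; rewrite dE ?mE // eqxx orbT.
apply/all_flatten_iotaP => r lt_r; apply/all_map_iotaP => s lt_s; apply/hasE.
have /parity_pattern/(_ s lt_s) := H3 r lt_r.
rewrite /parity_clause; case/orP => [->|/hasP[u]]; first by exists 0.
rewrite mem_iota => lt_u Hu; exists u; first by lia.
by rewrite dE ?mE ?Hu ?andbT ?orbT //; lia.
Qed.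

Lemma clauses_sat m :
  weighted_circuit_sat 2 2 (circuit_code (cnf (k.+1 * n.+1) (clauses m))) k.+1 <->
  exists2 pick : nat -> nat, forall i, i < k.+1 -> pick i < n.+1 & picks_ok m pick.
Proof.
apply: (iff_trans (cnf_sat_pick _)) => [Q|].
  rewrite all_cat => /andP[/all_map_iotaP HQ _] i /HQ Hi.
  by exists (block_clause i) => // w /andP[/eqP].
by split=> -[pick Hp H]; exists pick => //; apply/(clauses_pick m Hp).
Qed.

End Clauses.

(** * From picks to sets of columns *)

Section Columns.

Variables (m n : nat) (H : 'M['F_2]_(m, n)) (h : nat -> nat -> bool).
Hypothesis hE : forall (i : 'I_m) (j : 'I_n), h i j = (H i j == 1%R).

Definition times k (pick : nat -> nat) j : nat := \sum_(0 <= i < k) (pick i == j).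

(** Only columns picked an odd number of times are removed, since equal picks cancel in pairs over
    ['F_2]. *)
Definition kept k pick : {set 'I_n} := [set j : 'I_n | ~~ odd (times k pick j)].

Lemma odd_sum I (r : seq I) (P : pred I) F :
  odd (\sum_(i <- r | P i) F i) = \big[addb/false]_(i <- r | P i) odd (F i).
Proof. exact: (big_morph odd oddD). Qed.

Lemma natr_F2 a : (a%:R == 0 :> 'F_2)%R = ~~ odd a.
Proof.
rewrite -[a in LHS](odd_double_half a) GRing.natrD -muln2 GRing.natrM.
have -> : (2%:R = 0 :> 'F_2)%R by apply: val_inj.
by rewrite GRing.mulr0 GRing.addr0; case: (odd a).
Qed.

Lemma sum_col_eq0 (S : {set 'I_n}) :
  (\sum_(j in S) col j H = 0)%R <->
  forall r : 'I_m, ~~ odd (\sum_(j in S) h r j).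
Proof.
have E (r : 'I_m) : ((\sum_(j in S) col j H)%R r ord0 == 0)%R = ~~ odd (\sum_(j in S) h r j).
  rewrite summxE -natr_F2 GRing.natr_sum; congr (_ == _)%R.
  apply: eq_bigr => j _; rewrite mxE hE.
  by case: (H r j) => -[|[|a]] Ha //; apply: val_inj.
split=> [E0 r|H0]; first by rewrite -E E0 mxE.
by apply/colP => r; rewrite mxE; apply/eqP; rewrite E.
Qed.

(** In the picks and the full row together, column [j] is counted [times k pick j + 1] times, which
    is odd exactly if it is kept. *)
Lemma picks_parity k pick :
  (forall r, r < m -> odd (\sum_(0 <= i < k) ((pick i < n) && h r (pick i))) =
     row_parity n h r) <->
  (\sum_(j in kept k pick) col j H = 0)%R.
Proof.
have E (r : nat) : odd (\sum_(0 <= i < k) ((pick i < n) && h r (pick i))) (+) row_parity n h r =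
    odd (\sum_(j in kept k pick) h r j).
  have -> : \sum_(0 <= i < k) ((pick i < n) && h r (pick i)) =
      \sum_(j < n) times k pick j * h r j.
    under [RHS]eq_bigr do rewrite /times big_distrl /=.
    rewrite exchange_big /=; apply: eq_bigr => i _.
    case: ltnP => [lt|ge].
      rewrite (bigD1 (Ordinal lt)) //= eqxx mul1n big1 ?addn0 // => j.
      by rewrite -val_eqE eq_sym => /negbTE/= ->.
    by rewrite big1 // => j _; case: eqP => // Ej; have := ltn_ord j; lia.
  rewrite /row_parity big_mkord -oddD -big_split /= !odd_sum [RHS]big_mkcond /=.
  apply: eq_bigr => j _; rewrite inE oddD oddM oddb.
  by case: (odd _); case: (h r j).
rewrite sum_col_eq0; split=> Hr r; first by rewrite -E Hr // addbb.
move=> lt_r; have := Hr (Ordinal lt_r); rewrite -E /=.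
by case: (odd _); case: row_parity.
Qed.

Lemma sum_times k pick :
  \sum_(j < n) times k pick j = \sum_(0 <= i < k) (pick i < n).
Proof.
rewrite exchange_big /=; apply: eq_bigr => i _; case: ltnP => [lt|ge].
  rewrite (bigD1 (Ordinal lt)) //= eqxx big1 // => j.
  by rewrite -val_eqE eq_sym => /negbTE/= ->.
by rewrite big1 // => j _; case: eqP => // Ej; have := ltn_ord j; lia.
Qed.

Lemma card_keptC k pick : #|~: kept k pick| = \sum_(j < n) odd (times k pick j).
Proof.
rewrite -sum1_card big_mkcond; apply: eq_bigr => j _.
by rewrite !inE negbK; case: odd.
Qed.

(** The picks enumerate the complement of [S]; the default [n] of [nth] lets all further blocks pick
    no column. *)
Lemma kept_ex k (S : {set 'I_n}) : #|~: S| <= k ->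
  exists2 pick : nat -> nat, kept k pick = S &
    [/\ forall i, pick i < n.+1,
        forall i, i < #|~: S| -> pick i < n,
        forall i i', i < i' < k -> pick i < n -> pick i != pick i' &
        forall i (j : 'I_n), j \in S -> pick i != j].
Proof.
move=> le_k; pose t := map val (enum (~: S)); pose pick i := nth n t i.
have sz : size t = #|~: S| by rewrite size_map -cardE.
have Ut : uniq t by rewrite map_inj_uniq ?enum_uniq //; apply: val_inj.
have tE (j : 'I_n) : (val j \in t) = (j \notin S).
  by rewrite mem_map ?mem_enum ?inE //; apply: val_inj.
have t_lt i : i < size t -> nth n t i < n.
  by move=> lt_i; have /mapP[j _ ->] := mem_nth n lt_i; apply: ltn_ord.
exists pick; last split=> [i|i lt_i|i i' lt_i' lt_n|i j jS].
- apply/setP => j; rewrite inE /times (big_cat_nat (n := #|~: S|)) //=.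
  have -> : \sum_(#|~: S| <= i < k) (pick i == j) = 0.
    rewrite big_nat_cond big1 // => i /andP[/andP[ge _] _].
    rewrite /pick nth_default ?sz //; case: eqP => // Ej.
    by have := ltn_ord j; lia.
  rewrite addn0.
  have -> : \sum_(0 <= i < #|~: S|) (pick i == j) = (val j \in t).
    rewrite -sz -(big_nth n xpredT (fun i => (i == val j) : nat)).
    rewrite -[RHS](count_uniq_mem _ Ut) -sum1_count [RHS]big_mkcond.
    by apply: eq_bigr => i _; rewrite /=; case: eqP.
  by rewrite oddb tE negbK.
- have [lt|ge] := ltnP i (size t); first by rewrite ltnW // ltnS t_lt.
  by rewrite /pick nth_default.
- by apply: t_lt; rewrite sz.
- case/andP: lt_i' => lt_i' _; have [lt|ge] := ltnP i' (size t).
    by rewrite nth_uniq ?(ltn_trans lt_i' lt) // neq_ltn lt_i'.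
  have -> : pick i' = n by exact: nth_default.
  by rewrite neq_ltn lt_n.
have [lt|ge] := ltnP i (size t).
  apply/eqP => Ej; have := mem_nth n lt.
  by rewrite -/(pick i) Ej tE jS.
by rewrite /pick nth_default // neq_ltn ltn_ord orbT.
Qed.

(** Distinct picks make every [times] at most 1, so exactly [k] columns are removed. Conversely the
    first [k] blocks enumerate the complement and the last one picks [n]. *)
Lemma picks_exact k :
  (exists2 pick, forall i, i < k.+1 -> pick i < n.+1 & picks_ok true k n h m pick) <->
  exists S : {set 'I_n}, #|S| + k = n /\ (\sum_(j in S) col j H = 0)%R.
Proof.
split=> [[pick Hp [H1 H2 /picks_parity H3]]|[S [cS HS]]].
  exists (kept k pick); split=> //.
  have Hn i : i < k -> pick i < n by move=> lt_i; have := H1 i; rewrite /allowed; lia.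
  have Et (j : 'I_n) : odd (times k pick j) = times k pick j :> nat.
    suff: times k pick j <= 1 by case: times => [|[]].
    rewrite /times big_mkord; under eq_bigr do rewrite -[nat_of_bool _]/(if _ then 1 else 0).
    rewrite -big_mkcond sum1_card; apply/card_le1_eqP => a b.
    rewrite !unfold_in => /eqP Ea /eqP Eb; apply: val_inj.
    have [lt|lt|//] := ltngtP (val a) (val b).
      have := H2 a b j; have := ltn_ord a; have := ltn_ord b; have := ltn_ord j.
      by rewrite /conflict /= Ea Eb eqxx lt; lia.
    have := H2 b a j; have := ltn_ord a; have := ltn_ord b; have := ltn_ord j.
    by rewrite /conflict /= Ea Eb eqxx lt; lia.
  have : #|~: kept k pick| = k.
    rewrite card_keptC; under eq_bigr do rewrite Et.
    rewrite sum_times -[RHS](muln1 k) -[k in RHS]subn0 -sum_nat_const_nat.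
    by apply: eq_big_nat => i /andP[_ /Hn->].
  by have := cardsC (kept k pick); rewrite card_ord; lia.
have cC : #|~: S| = k by have := cardsC S; rewrite card_ord; lia.
have [|pick ES [P1 P2 P3 P4]] := @kept_ex k S; first by rewrite cC.
rewrite cC in P2.
exists (fun i => if i < k then pick i else n) => [i _|]; first by case: ifP.
split=> [i _|i i' j lt_i lt_i' lt_j|].
- by rewrite /allowed; case: (ltnP i k) => [lt|ge]; [have := P2 i lt; lia | lia].
- rewrite /conflict => /andP[lt_ii _].
  case: ltnP => [lt|ge]; case: ltnP => [lt'|ge']; try by lia.
  have := P3 i i'; rewrite lt' lt_ii P2 // => /(_ isT isT) /eqP; lia.
rewrite -ES in HS; move/picks_parity: HS => HS r /HS <-; congr odd.
by apply: eq_big_nat => i /andP[_ ->].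
Qed.

(** The column of the last block is picked by none of the first [k], so it is kept; repetitions only
    make the complement smaller. Conversely the last block picks any element of [S]. *)
Lemma picks_min k :
  (exists2 pick, forall i, i < k.+1 -> pick i < n.+1 & picks_ok false k n h m pick) <->
  exists S : {set 'I_n},
    [/\ S != set0, n <= #|S| + k & (\sum_(j in S) col j H = 0)%R].
Proof.
split=> [[pick Hp [H1 H2 /picks_parity H3]]|[S [nS cS HS]]].
  exists (kept k pick); split=> //.
    have lt_n : pick k < n by have := H1 k; rewrite /allowed; lia.
    apply/set0Pn; exists (Ordinal lt_n); rewrite inE /times big_nat_cond big1 // => i.
    move=> /andP[/andP[_ lt_i] _]; have := H2 i k (pick k).
    by rewrite /conflict /= lt_i eqxx; case: eqP => // _; lia.
  have : #|~: kept k pick| <= k.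
    rewrite card_keptC; apply: leq_trans (_ : \sum_(j < n) times k pick j <= _).
      by apply: leq_sum => j _; case: times => [|[|a]] //; case: odd.
    rewrite sum_times -[X in _ <= X](muln1 k) -[X in _ <= X * _]subn0 -sum_nat_const_nat.
    by apply: leq_sum => i _; apply: leq_b1.
  by have := cardsC (kept k pick); rewrite card_ord; lia.
have cC : #|~: S| <= k by have := cardsC S; rewrite card_ord; lia.
have [pick ES [P1 P2 P3 P4]] := kept_ex cC.
have [j0 j0S] := set0Pn _ nS.
exists (fun i => if i < k then pick i else j0) => [i _|].
  by case: ifP => // _; rewrite ltnS ltnW.
split=> [i _|i i' j lt_i lt_i' lt_j|].
- by rewrite /allowed /= orbT; case: (ltnP i k) => //= _; apply: ltn_ord.
- rewrite /conflict /= => /andP[lt_ii /eqP Ei]; subst i'.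
  rewrite lt_ii ltnn; have := P4 i j0 j0S.
  by case: (eqVneq (pick i) j) => //= <-; rewrite eq_sym.
rewrite -ES in HS; move/picks_parity: HS => HS r /HS <-; congr odd.
by apply: eq_big_nat => i /andP[_ ->].
Qed.

End Columns.

(** * The reduction *)

Lemma cfun_eqb X (inp : X -> seq bool) (vars : seq (X -> nat))
    (P Q : X -> bool) : cfun inp vars (fun x => P x) ->
  cfun inp vars (fun x => Q x) -> cfun inp vars (fun x => P x == Q x).
Proof.
by move=> HP HQ; apply: eq_cfun (cfun_eq HP HQ) => x; case: (P x); case: (Q x).
Qed.

Lemma cfun_bigsum X (inp : X -> seq bool) (vars : seq (X -> nat))
    (F : X -> nat) (G : X -> nat -> nat) : cfun inp vars F ->
  cfun (fun p => inp p.1) (vars' vars) (fun p => G p.1 p.2) ->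
  cfun inp vars (fun x => \sum_(0 <= i < F x) G x i).
Proof.
by move=> HF HG; apply: eq_cfun (cfun_sum HF HG) => x; rewrite big_mkord.
Qed.

Lemma cgen_unary X (inp : X -> seq bool) (vars : seq (X -> nat))
    (F : X -> nat) : cfun inp vars F -> cgen inp vars (fun x => unary (F x)).
Proof.
move=> HF; apply: eq_cgen (cgen_cat (cgen_for (G := fun _ _ => [:: true]) HF
  (cgen_bit _ _ true)) (cgen_bit _ _ false)) => x.
rewrite /unary -cats1; congr (_ ++ _).
by elim: (F x) 0 => //= n IH i; rewrite IH.
Qed.

Lemma cgen_wires X (inp : X -> seq bool) (vars : seq (X -> nat))
    (N F : X -> nat) : cfun inp vars N -> cfun inp vars F ->
  cgen inp vars (fun x => wires_code (iota (N x) (F x))).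
Proof.
move=> HN HF.
have HG : cgen (fun p => inp p.1) (vars' vars) (fun p => [:: true] ++ unary (N p.1 + p.2)).
  apply: cgen_cat; first exact: cgen_bit.
  apply: cgen_unary; apply: cfun_add (@cfun_var _ _ (vars' vars) 0 isT).
  exact: cfun_weak.
apply: eq_cgen (cgen_cat (cgen_for (G := fun x i => [:: true] ++ unary (N x + i)) HF HG)
  (cgen_bit _ _ false)) => x.
rewrite /wires_code -cats1; congr (flatten _ ++ _).
by have := iotaDl (N x) 0 (F x); rewrite addn0 => ->; rewrite -map_comp.
Qed.

Lemma cgen_or X (inp : X -> seq bool) (vars : seq (X -> nat))
    (N : X -> nat) (phi : X -> pred nat) : cfun inp vars N ->
  cfun (fun p => inp p.1) (vars' vars) (fun p => phi p.1 p.2) ->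
  cgen inp vars (fun x => gate_code (Or (clause (N x) (phi x)))).
Proof.
move=> HN Hphi.
have HG : cgen (fun p => inp p.1) (vars' vars)
    (fun p => if phi p.1 p.2 then [:: true] ++ unary p.2 else [::]).
  apply: cgen_if => //; last exact: cgen_nil.
  apply: cgen_cat; first exact: cgen_bit.
  exact: cgen_unary (@cfun_var _ _ (vars' vars) 0 isT).
apply: eq_cgen (cgen_cat (cgen_cat (cgen_bit _ _ true) (cgen_bit _ _ true)) (cgen_cat
  (cgen_for (G := fun x i => if phi x i then [:: true] ++ unary i else [::]) HN HG)
  (cgen_bit _ _ false))) => x.
rewrite /= /wires_code -cats1; congr [:: _, _ & _ ++ _].
by rewrite /clause; elim: iota => //= i s ->; case: ifP.
Qed.

(** Expresses [lead] by bounded sums, to which the closure properties apply: [i < lead s] iff there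
    is no [false] up to position [i]. *)
Lemma sum_lead (s : seq bool) L : size s <= L ->
  \sum_(0 <= i < L) (\sum_(0 <= j < i.+1) ~~ nth false s j == 0) = lead s.
Proof.
move=> le_L; have le_lead : lead s <= L by apply: leq_trans (find_size _ _) le_L.
rewrite big_mkord -[RHS](sum_ltn le_lead); apply: eq_bigr => i _; congr nat_of_bool.
case: ltnP => [lt|ge].
  apply/eqP; rewrite big_nat_cond big1 // => j /andP[/andP[_ lt_j] _].
  by rewrite lead_true //; apply: leq_trans lt_j _.
apply/negbTE; rewrite -lt0n big_mkord (bigD1 (Ordinal (ge : lead s < i.+1))) //=.
by rewrite lead_false.
Qed.

(** Directed by the outermost operation. What remains must be a variable, and at most nine are in
    scope: two initial ones, three dimensions, and four indices of loops, wires or sums. *)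
Ltac cf :=
  cbv beta;
  lazymatch goal with
  | |- cfun _ _ (fun _ => ?c) => exact: cfun_const
  | |- cfun ?i ?v (fun x => nat_of_bool (leq (@?F x) (@?G x))) =>
      apply: (@cfun_leq _ i v F G); cf
  | |- cfun ?i ?v (fun x => nat_of_bool (@eq_op _ (@?F x) (@?G x))) =>
      first [apply: (@cfun_eq _ i v F G) | apply: (@cfun_eqb _ i v F G)]; cf
  | |- cfun ?i ?v (fun x => nat_of_bool (~~ (@?F x))) => apply: (@cfun_not _ i v F); cf
  | |- cfun ?i ?v (fun x => nat_of_bool ((@?F x) && (@?G x))) =>
      apply: (@cfun_and _ i v F G); cf
  | |- cfun ?i ?v (fun x => nat_of_bool ((@?F x) || (@?G x))) =>
      apply: (@cfun_or _ i v F G); cf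
  | |- cfun ?i ?v (fun x => nat_of_bool (odd (iter (@?F x) half (@?G x)))) =>
      apply: (@cfun_bit _ i v F G); cf
  | |- cfun ?i ?v (fun x => nat_of_bool (odd (@?F x))) => apply: (@cfun_odd _ i v F); cf
  | |- cfun ?i ?v (fun x => nat_of_bool (nth false _ (@?F x))) =>
      apply: (@cfun_read _ i v F); cf
  | |- cfun ?i ?v (fun x => (@?F x).+1) => apply: (@cfun_succ _ i v F); cf
  | |- cfun ?i ?v (fun x => (@?F x) + (@?G x)) => apply: (@cfun_add _ i v F G); cf
  | |- cfun ?i ?v (fun x => (@?F x) * (@?G x)) => apply: (@cfun_mul _ i v F G); cf
  | |- cfun ?i ?v (fun x => (@?F x) %/ (@?G x).+1) => apply: (@cfun_div _ i v F G); cf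
  | |- cfun ?i ?v (fun x => (@?F x) %% (@?G x).+1) => apply: (@cfun_mod _ i v F G); cf
  | |- cfun ?i ?v (fun x => \sum_(0 <= j < @?F x) (@?G x j)) =>
      apply: (@cfun_bigsum _ i v F G); cf
  | |- cfun ?i ?v _ => first [exact: (@cfun_var _ i v 0 isT) | exact: (@cfun_var _ i v 1 isT)
     | exact: (@cfun_var _ i v 2 isT) | exact: (@cfun_var _ i v 3 isT)
     | exact: (@cfun_var _ i v 4 isT) | exact: (@cfun_var _ i v 5 isT)
     | exact: (@cfun_var _ i v 6 isT) | exact: (@cfun_var _ i v 7 isT)
     | exact: (@cfun_var _ i v 8 isT)]
  end.

(** The input is [1^k 0 1^m 0 1^n 0] followed by the entries, whence the offsets. *)
Definition block2 z k := lead (drop k.+1 z).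
Definition block3 z k m := lead (drop (k + m + 2) z).
Definition entry z k m n r j := nth false z (k + m + n + 3 + (r * n + j)).

Definition nclauses z k m n := k.+1 + k.+1 * (k.+1 * n) + m * 2 ^ lead z.

Section Reduction.

Variable exact : bool.

(** Streams the parameter and the circuit gate by gate; [[:: true] ++ [:: false]] is the tag of
    [And]. The number of patterns is written [2 ^ lead z], which is a variable, as [cf] has no
    exponentiation. *)
Definition reduction_body (z : seq bool) (k m n : nat) : seq bool :=
  unary k.+1 ++ unary (k.+1 * n.+1) ++
  flatten [seq gate_code (Or (clause (k.+1 * n.+1) (block_clause exact k n i)))
    | i <- iota 0 k.+1] ++
  flatten [seq flatten [seq flatten [seq
      gate_code (Or (clause (k.+1 * n.+1) (distinct_clause exact k n i i' j)))
    | j <- iota 0 n] | i' <- iota 0 k.+1] | i <- iota 0 k.+1] ++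
  flatten [seq flatten [seq
      gate_code (Or (clause (k.+1 * n.+1) (parity_clause k n (entry z k m n) r s)))
    | s <- iota 0 (2 ^ lead z)] | r <- iota 0 m] ++
  ([:: true] ++ [:: false]) ++ wires_code (iota (k.+1 * n.+1) (nclauses z k m n)).

(** An input of the wrong length goes to [[:: false]], the pair of the empty word and 0. This is a
    no-instance because no circuit has an empty code. *)
Definition reduction (z : seq bool) : seq bool :=
  let k := lead z in let m := block2 z k in let n := block3 z k m in
  if size z == k + m + n + 3 + m * n then reduction_body z k m n else [:: false].

Lemma cgen_reduction : cgen id vars0 reduction.
Proof.
rewrite /reduction.
apply: (@cgen_let _ _ _ lead (fun z k => let m := block2 z k in let n := block3 z k m in
  if size z == k + m + n + 3 + m * n then reduction_body z k m n else [:: false])).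
  apply: (@eq_cfun _ _ _ (fun z => \sum_(0 <= i < size z)
    (\sum_(0 <= j < i.+1) ~~ nth false z j == 0))).
    by move=> z; rewrite sum_lead.
  cf.
set x0 := (x in cgen _ (vars' x)).
apply: (@cgen_let _ _ _ (fun p => block2 p.1 p.2) (fun p m => let n := block3 p.1 p.2 m in
  if size p.1 == p.2 + m + n + 3 + m * n then reduction_body p.1 p.2 m n else [:: false])).
  apply: (@eq_cfun _ _ _ (fun p => \sum_(0 <= i < size p.1)
    (\sum_(0 <= j < i.+1) ~~ nth false p.1 (p.2.+1 + j) == 0))).
    move=> p; rewrite /block2 -(@sum_lead _ (size p.1)) ?size_drop ?leq_subr //.
    by under eq_bigr do under eq_bigr do rewrite -nth_drop.
  cf.
apply: (@cgen_let _ _ _ (fun p => block3 p.1.1 p.1.2 p.2) (fun p n =>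
  if size p.1.1 == p.1.2 + p.2 + n + 3 + p.2 * n then reduction_body p.1.1 p.1.2 p.2 n
  else [:: false])).
  apply: (@eq_cfun _ _ _ (fun p => \sum_(0 <= i < size p.1.1)
    (\sum_(0 <= j < i.+1) ~~ nth false p.1.1 (p.1.2 + p.2 + 2 + j) == 0))).
    move=> p; rewrite /block3 -(@sum_lead _ (size p.1.1)) ?size_drop ?leq_subr //.
    by under eq_bigr do under eq_bigr do rewrite -nth_drop.
  cf.
apply: cgen_if; [cf | | exact: cgen_bit].
rewrite /reduction_body /nclauses.
apply: cgen_cat; first by apply: cgen_unary; cf.
apply: cgen_cat; first by apply: cgen_unary; cf.
apply: cgen_cat.
  apply: cgen_for; first cf.
  apply: cgen_or; first cf.
  rewrite /block_clause /allowed; cf.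
apply: cgen_cat.
  apply: cgen_for; first cf.
  apply: cgen_for; first cf.
  apply: cgen_for; first cf.
  apply: cgen_or; first cf.
  rewrite /distinct_clause /conflict; cf.
apply: cgen_cat.
  apply: cgen_for; first cf.
  apply: cgen_for; first cf.
  apply: cgen_or; first cf.
  rewrite /parity_clause /row_parity /parity /bit /entry; cf.
apply: cgen_cat; first by apply: cgen_cat; apply: cgen_bit.
by apply: cgen_wires; cf.
Qed.

Lemma flatten_map_flatten (S T : Type) (f : S -> seq T) (ss : seq (seq S)) :
  flatten (map f (flatten ss)) = flatten [seq flatten (map f s) | s <- ss].
Proof. by elim: ss => //= s ss IH; rewrite map_cat flatten_cat IH. Qed.

Lemma size_clauses k n h m :
  size (clauses exact k n h m) = k.+1 + k.+1 * (k.+1 * n) + m * 2 ^ k.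
Proof.
have sz T (F : nat -> seq T) c N : (forall i, size (F i) = c) ->
    size (flatten [seq F i | i <- iota 0 N]) = N * c.
  move=> HF; rewrite -{2}(size_iota 0 N); elim: iota => //= i s IH.
  by rewrite size_cat HF IH mulSn.
rewrite /clauses 2!size_cat size_map size_iota addnA; congr (_ + _ + _).
  by apply: (sz) => i; apply: (sz) => i'; rewrite size_map size_iota.
by apply: (sz) => i; rewrite size_map size_iota.
Qed.

Lemma flatten_map_clauses T (f : pred nat -> seq T) k n h m :
  flatten [seq f phi | phi <- clauses exact k n h m] =
  flatten [seq f (block_clause exact k n i) | i <- iota 0 k.+1] ++
  flatten [seq flatten [seq flatten [seq f (distinct_clause exact k n i i' j)
    | j <- iota 0 n] | i' <- iota 0 k.+1] | i <- iota 0 k.+1] ++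
  flatten [seq flatten [seq f (parity_clause k n h r s) | s <- iota 0 (2 ^ k)]
    | r <- iota 0 m].
Proof.
rewrite /clauses; move: k.+1 => K.
rewrite 2!map_cat 2!flatten_cat -map_comp !flatten_map_flatten -!map_comp.
congr (_ ++ (flatten _ ++ flatten _)); apply: eq_map => i /=; last by rewrite -map_comp.
rewrite flatten_map_flatten -map_comp; congr flatten; apply: eq_map => i' /=.
by rewrite -map_comp.
Qed.

Lemma reduction_bodyE z m n (k := lead z) :
  reduction_body z k m n =
  pair_code (circuit_code (cnf (k.+1 * n.+1) (clauses exact k n (entry z k m n) m))) k.+1.
Proof.
rewrite /reduction_body /pair_code /circuit_code; congr (_ ++ (_ ++ _)).
rewrite /cnf /gates map_rcons flatten_rcons -map_comp size_clauses flatten_map_clauses.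
by rewrite -!catA.
Qed.

End Reduction.

(** * Decoding the matrix and correctness *)

Lemma lead_split s : lead s < size s -> s = unary (lead s) ++ drop (lead s).+1 s.
Proof.
elim: s => //= -[|] s IH lt_s; last by rewrite drop0.
by rewrite {1}IH.
Qed.

Lemma entries_of_bits m n (w : seq bool) : size w = m * n ->
  [seq nth false w (i * n + j) | i : 'I_m <- enum 'I_m, j : 'I_n <- enum 'I_n] = w.
Proof.
move=> sz.
have -> : [seq nth false w (i * n + j) | i : 'I_m <- enum 'I_m, j : 'I_n <- enum 'I_n] =
    flatten [seq [seq nth false w (i * n + j) | j <- iota 0 n] | i <- iota 0 m].
  rewrite -(val_enum_ord m) -map_comp; congr flatten; apply: eq_map => i /=.
  by rewrite -(val_enum_ord n) -map_comp.
elim: m w sz => [|m IH] w sz; first by case: w sz.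
rewrite /= (iotaDl 1 0 m) -map_comp.
rewrite (eq_map (g := fun i => [seq nth false (drop n w) (i * n + j) | j <- iota 0 n])).
  rewrite IH ?size_drop ?sz ?mulSn ?addKn // map_nth_iota0 ?cat_take_drop //.
  by rewrite sz mulSn leq_addr.
move=> i /=; apply: eq_map => j.
by rewrite nth_drop mulSn addnA.
Qed.

(** Treats both problems at once: [C] stands for the existence of a suitable set of columns. *)
Lemma reduction_correct (exact : bool)
    (C : forall m n, 'M['F_2]_(m, n) -> nat -> Prop) :
    (forall m n (H : 'M['F_2]_(m, n)) (h : nat -> nat -> bool) k,
       (forall (i : 'I_m) (j : 'I_n), h i j = (H i j == 1%R)) ->
       (exists2 pick, forall i, i < k.+1 -> pick i < n.+1 & picks_ok exact k n h m pick) <->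
       C m n H k) ->
  forall x k, exists x' k',
    [/\ reduction exact (pair_code x k) = pair_code x' k', k' <= k.+1 &
        (exists m n (H : 'M['F_2]_(m, n)), x = matrix_code H /\ C m n H k) <->
        weighted_circuit_sat 2 2 x' k'].
Proof.
move=> HC x k; set z := pair_code x k.
have Ek : lead z = k := lead_unary k x.
have drop_z i : drop (k.+1 + i) z = drop i x.
  rewrite addnC -drop_drop drop_size_cat //.
  by rewrite size_rcons size_nseq.
have Em : block2 z k = lead x by rewrite /block2 -[k.+1]addn0 drop_z drop0.
set m := lead x in Em.
have En : block3 z k m = lead (drop m.+1 x).
  by rewrite /block3 -drop_z; congr (lead (drop _ _)); lia.
set n := lead (drop m.+1 x) in En.
have sz_z : size z = k.+1 + size x by rewrite size_cat size_rcons size_nseq.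
rewrite /reduction Ek Em En; case: eqP => [E|nE].
  (* Any word of the right length codes a matrix, whose entries are the last [m * n] bits. *)
  have sz_x : size x = m + n + 2 + m * n by lia.
  pose w := drop (m + n + 2) x.
  have Ex : x = unary m ++ unary n ++ w.
    rewrite {1}(@lead_split x) -/m; last by rewrite -/m; lia.
    congr (_ ++ _); rewrite {1}(@lead_split (drop m.+1 x)) -/n.
      by rewrite drop_drop /w; congr (_ ++ drop _ _); lia.
    by rewrite -/n size_drop; lia.
  pose H : 'M['F_2]_(m, n) := (\matrix_(i, j) (nth false w (i * n + j))%:R)%R.
  have HE i j : (H i j == 1%R) = nth false w (i * n + j).
    by rewrite mxE; case: nth.
  have EH : x = matrix_code H.
    rewrite {1}Ex /matrix_code; congr (_ ++ (_ ++ _)).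
    rewrite -[LHS](@entries_of_bits m n); last by rewrite size_drop; lia.
    by apply: eq_allpairs => i j; rewrite HE.
  exists (circuit_code (cnf (k.+1 * n.+1) (clauses exact k n (entry z k m n) m))), k.+1.
  split=> //; first by rewrite -[in RHS]Ek -reduction_bodyE Ek.
  rewrite clauses_sat (HC m n H).
    (* As codes are injective, [H] is the only matrix that [x] can denote. *)
    split=> [[m' [n' [H' [E' HH']]]]|HH]; last by exists m, n, H.
    have := E'; rewrite {1}EH => /matrix_code_dim[Em' En'].
    move: H' E' HH'; rewrite -Em' -En' => H' E' HH'.
    by rewrite EH in E'; rewrite (matrix_code_inj E').
  move=> i j; rewrite HE /entry /w.
  have <- : drop (k.+1 + (m + n + 2)) z = drop (m + n + 2) x := drop_z _.
  by rewrite nth_drop; congr nth; lia.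
(* A word of the wrong length codes no matrix and the empty word codes no circuit, so both sides
   fail. *)
exists [::], 0; split=> //; split=> [[m' [n' [H [E _]]]]|[D [E _ _ _ _]]].
  case: nE; rewrite sz_z.
  have Em' : m = m' by rewrite /m E lead_unary.
  have Ed : drop m.+1 x = unary n' ++ [seq H i j == 1%R | i <- enum 'I_m', j <- enum 'I_n'].
    by rewrite E Em' drop_size_cat // size_rcons size_nseq.
  have En' : n = n' by rewrite /n Ed lead_unary.
  have := congr1 size Ed; rewrite size_drop size_cat size_allpairs size_rcons size_nseq.
  by rewrite !size_enum_ord -Em' -En'; have := congr1 size E;
     rewrite size_cat size_rcons size_nseq; lia.
by have := congr1 size E; rewrite size_cat size_rcons.
Qed.

Lemma computable_succ : computable succn.
Proof.
apply: (@cfun_computable _ (fun z => (size z).+1)).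
  exact: cfun_succ (@cfun_var _ id vars0 0 isT).
by move=> k; rewrite size_nseq.
Qed.

Theorem theorem9 : W 2 dual_minimum_distance /\ W 2 dual_weight_distribution.
Proof.
split; exists 2.
  apply: (cgen_fpt_reducible (cgen_reduction false) computable_succ).
  by apply: reduction_correct => m n H h k hE; exact: picks_min.
apply: (cgen_fpt_reducible (cgen_reduction true) computable_succ).
by apply: reduction_correct => m n H h k hE; exact: picks_exact.
Qed.
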